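(* Given algebras $\mathcal{A}(\rho_1,\varepsilon_1)$ generated by $\{X_0,X_+,X_-\}$ and $\mathcal{A}(\rho_2,\varepsilon_2)$ generated by $\{Y_0,Y_+,Y_-\}$ (in the sense of the context), and given analytic functions $\sigma_\pm:\mathbb{C}\to\mathbb{C}\setminus\{0\}$ and $\lambda\in\mathbb{C}$ such that $$\rho_1\left(\frac{\varepsilon_1}{\varepsilon_2}u+\lambda\right)=\rho_2(u)\,\sigma_+(u)\,\sigma_-(u),$$ there exists a homomorphism of algebras $$\mathcal{A}(\rho_1,\varepsilon_1)\to\mathcal{A}(\rho_2,\sigma_+,\sigma_-,\varepsilon_2),\qquad X_0\mapsto\frac{\varepsilon_1}{\varepsilon_2}Y_0+\lambda,\quad X_+\mapsto\sigma_+(Y_0)Y_+,\quad X_-\mapsto Y_-\sigma_-(Y_0),$$ where $\mathcal{A}(\rho_2,\sigma_+,\sigma_-,\varepsilon_2)$ is the enlarged algebra generated by $$\mathcal{A}(\rho_2,\varepsilon_2)\cup\{\sigma_+(Y_0+r\varepsilon_2),\ \sigma_-(Y_0+r\varepsilon_2): r\in\mathbb{Z}\}.$$ This mapping is injective but not necessarily surjective. If $\rho_1$ and $\rho_2$ are real, then this mapping preserves conjugation if and only if $\overline{\sigma_+(u)}=\sigma_-(u)$ and $\lambda\in\mathbb{R}$. If the mapping preserves conjugation, then $\mathcal{M}_{\rho_1}$ is topologically equivalent to $\mathcal{M}_{\rho_2}$ and $$\frac{|I_{\rho_1}|}{\varepsilon_1}=\frac{|I_{\rho_2}|}{\vareps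ilon_2}.$$
   Context: For an analytic function $\rho:\mathbb{C}\to\mathbb{C}$ and a constant $\varepsilon\in\mathbb{C}$, $\mathcal{A}(\rho,\varepsilon)$ is the algebra of polynomials generated by the elements $\{X_0,X_+,X_-\}\cup\{\rho(X_0+r\varepsilon): r\in\mathbb{Z}\}$, quotiented by the ideal generated by $$[X_0,X_+]=\varepsilon X_+,\quad [X_0,X_-]=-\varepsilon X_-,\quad X_+X_-=\rho(X_0),\quad X_-X_+=\rho(X_0+\varepsilon).$$ The elements $\rho(X_0+r\varepsilon)$ are understood as functions of $X_0$. The same definition, with $Y$ in place of $X$, applies to $\mathcal{A}(\rho_2,\varepsilon_2)$, and the elements $\sigma_\pm(Y_0+r\varepsilon_2)$ of the enlarged algebra are likewise understood as functions of $Y_0$. $\rho$ is called real if $\rho$ maps $\mathbb{R}$ to $\mathbb{R}$. In that case there is a conjugation on $\mathcal{A}(\rho,\varepsilon)$ given by $X_0^\dagger=X_0$, $X_+^\dagger=X_-$, $X_-^\dagger=X_+$, with $(ab)^\dagger=b^\dagger a^\dagger$ and complex conjugation on scalars; the parameter $\varepsilon$ is taken to be self-Hermitian ($\varepsilon^\dagger=\varepsilon$). For real $\rho$: $I_\rho=\{u\in\mathbb{R}:\rho(u)>0\}$ and $\mathcal{M}_\rho=\{(x,y,z)\in\mathbb{R}^3:x^2+y^2=\rho(z)\}$. If $I_\rho$ is connected, $|I_\rho|$ denotes the difference between the two endpoints of $I_\rho$ if $I_\rho$ is bounded, and infinity otherwise; non-connected $I_\rho$ are not considered.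
   Formalization: Injectivity and the geometric claims assume ε₁≠0; the length identity is proved as written only for ε₁/ε₂>0, and with |ε₁|, |ε₂| in general (it fails for ε₁/ε₂<0); the condition conj σ₊(u)=σ₋(u) is taken for real u. *)

(* Defs.v *)
From HB Require Import structures.
From mathcomp Require Import all_boot all_order all_algebra.
From mathcomp Require Import complex.
From mathcomp Require Import all_classical all_reals all_analysis.
Set Implicit Arguments.
Unset Strict Implicit.
Unset Printing Implicit Defensive.
Import Order.TTheory GRing.Theory Num.Theory.
Import numFieldNormedType.Exports.

Local Open Scope classical_set_scope.
Local Open Scope quotient_scope.
Local Open Scope ring_scope.
Local Open Scope complex_scope.

(* Noncommutative polynomial expressions in X_0, X_+, X_- and in the symbols
   standing for g (X_0 + r eps), r an integer, where g is rho ([None]) or one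
   of the functions of a further family indexed by J ([Some j]). *)
Inductive expr (K : fieldType) (J : Type) : Type :=
| ecst of K
| eX0
| eXp
| eXm
| eshift of option J & int
| eadd of expr K J & expr K J
| emul of expr K J & expr K J.

Arguments ecst {K J}.
Arguments eX0 {K J}.
Arguments eXp {K J}.
Arguments eXm {K J}.
Arguments eshift {K J}.

HB.instance Definition _ (K : fieldType) (J : Type) := gen_eqMixin (expr K J).
HB.instance Definition _ (K : fieldType) (J : Type) :=
  gen_choiceMixin (expr K J).

Section ShiftAlgebra.
Variables (K : fieldType) (J : Type).
Variables (rho : K -> K) (sigma : J -> K -> K) (eps : K).

Local Notation expr := (expr K J).

Fixpoint no_Xpm (s : expr) : bool :=
  match s with
  | ecst _ | eX0 | eshift _ _ => true
  | eXp | eXm => false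
  | eadd s1 s2 | emul s1 s2 => no_Xpm s1 && no_Xpm s2
  end.

(* The function of X_0 denoted by an expression without X_+ and X_-. The value
   on other expressions is irrelevant. *)
Fixpoint efun (s : expr) (u : K) : K :=
  match s with
  | ecst c => c
  | eX0 => u
  | eXp | eXm => 0
  | eshift g r => (if g is Some j then sigma j else rho) (u + r%:~R * eps)
  | eadd s1 s2 => efun s1 u + efun s2 u
  | emul s1 s2 => efun s1 u * efun s2 u
  end.

(* Equality modulo the defining ideal: the least congruence which makes
   expressions an associative unital K-algebra and contains the relations.
   That the elements g (X_0 + r eps) are functions of X_0 is rendered by
   [econg_fun] (expressions in X_0 and the g (X_0 + r eps) denoting the same
   function are identified; in particular they all commute) and by
   [econg_shift_p], [econg_shift_m], the relations
     f (X_0) X_+ = X_+ f (X_0 + eps)  and  f (X_0) X_- = X_- f (X_0 - eps)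
   for f = g (. + r eps); for f = id these are the given commutators. *)
Inductive econg : expr -> expr -> Prop :=
| econg_refl s : econg s s
| econg_sym s t : econg s t -> econg t s
| econg_trans s t w : econg s t -> econg t w -> econg s w
| econg_add s s' t t' :
    econg s s' -> econg t t' -> econg (eadd s t) (eadd s' t')
| econg_mul s s' t t' :
    econg s s' -> econg t t' -> econg (emul s t) (emul s' t')
| econg_addA s t w : econg (eadd s (eadd t w)) (eadd (eadd s t) w)
| econg_addC s t : econg (eadd s t) (eadd t s)
| econg_add0 s : econg (eadd (ecst 0) s) s
| econg_mulA s t w : econg (emul s (emul t w)) (emul (emul s t) w)
| econg_mul1 s : econg (emul (ecst 1) s) s
| econg_mul0 s : econg (emul (ecst 0) s) (ecst 0)
| econg_mulDl s t w :
    econg (emul (eadd s t) w) (eadd (emul s w) (emul t w))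
| econg_mulDr s t w :
    econg (emul s (eadd t w)) (eadd (emul s t) (emul s w))
| econg_cstC c s : econg (emul (ecst c) s) (emul s (ecst c))
| econg_fun s t : no_Xpm s -> no_Xpm t -> efun s =1 efun t -> econg s t
| econg_comm_p :
    econg (eadd (emul eX0 eXp) (emul (ecst (-1)) (emul eXp eX0)))
          (emul (ecst eps) eXp)
| econg_comm_m :
    econg (eadd (emul eX0 eXm) (emul (ecst (-1)) (emul eXm eX0)))
          (emul (ecst (- eps)) eXm)
| econg_shift_p g r :
    econg (emul (eshift g r) eXp) (emul eXp (eshift g (r + 1)))
| econg_shift_m g r :
    econg (emul (eshift g r) eXm) (emul eXm (eshift g (r - 1)))
| econg_pm : econg (emul eXp eXm) (eshift None 0)
| econg_mp : econg (emul eXm eXp) (eshift None 1).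

Definition econgb (s t : expr) : bool := `[< econg s t >].

Lemma econgb_refl : reflexive econgb.
Proof. by move=> s; apply/asboolP; exact: econg_refl. Qed.

Lemma econgb_sym : symmetric econgb.
Proof. by move=> s t; apply/asboolP/asboolP; exact: econg_sym. Qed.

Lemma econgb_trans : transitive econgb.
Proof.
by move=> t s w /asboolP st /asboolP tw; apply/asboolP; exact: econg_trans tw.
Qed.

Canonical econg_equiv := EquivRel econgb econgb_refl econgb_sym econgb_trans.

Definition shift_alg : Type := {eq_quot econg_equiv}.

HB.instance Definition _ := Choice.on shift_alg.
HB.instance Definition _ := EqQuotient.on shift_alg.

Lemma econgP s t : reflect (\pi_shift_alg s = \pi_shift_alg t) `[< econg s t >].
Proof. exact: (@eqmodP _ econg_equiv). Qed.

Lemma econg_pi s t : econg s t -> \pi_shift_alg s = \pi_shift_alg t.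
Proof. by move=> st; apply/econgP/asboolP. Qed.

Definition sa_cst (c : K) : shift_alg := \pi_shift_alg (ecst c).
Definition sa_add := lift_op2 shift_alg (@eadd K J).
Definition sa_mul := lift_op2 shift_alg (@emul K J).

Lemma pi_sa_add : {morph \pi_shift_alg : s t / eadd s t >-> sa_add s t}.
Proof.
move=> s t; unlock sa_add; apply: econg_pi; apply: econg_add;
  by apply/asboolP/econgP; rewrite reprK.
Qed.

Lemma pi_sa_mul : {morph \pi_shift_alg : s t / emul s t >-> sa_mul s t}.
Proof.
move=> s t; unlock sa_mul; apply: econg_pi; apply: econg_mul;
  by apply/asboolP/econgP; rewrite reprK.
Qed.

Definition sa_opp (a : shift_alg) := sa_mul (sa_cst (-1)) a.

Lemma sa_addA : associative sa_add.
Proof.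
elim/quotW=> s; elim/quotW=> t; elim/quotW=> w.
by rewrite -!pi_sa_add; apply: econg_pi; exact: econg_addA.
Qed.

Lemma sa_addC : commutative sa_add.
Proof.
elim/quotW=> s; elim/quotW=> t.
by rewrite -!pi_sa_add; apply: econg_pi; exact: econg_addC.
Qed.

Lemma sa_add0 : left_id (sa_cst 0) sa_add.
Proof.
elim/quotW=> s.
by rewrite -!pi_sa_add; apply: econg_pi; exact: econg_add0.
Qed.

Lemma sa_mulA : associative sa_mul.
Proof.
elim/quotW=> s; elim/quotW=> t; elim/quotW=> w.
by rewrite -!pi_sa_mul; apply: econg_pi; exact: econg_mulA.
Qed.

Lemma sa_mul1 : left_id (sa_cst 1) sa_mul.
Proof.
elim/quotW=> s.
by rewrite -!pi_sa_mul; apply: econg_pi; exact: econg_mul1.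
Qed.

Lemma sa_mul0 : left_zero (sa_cst 0) sa_mul.
Proof.
elim/quotW=> s.
by rewrite -!pi_sa_mul; apply: econg_pi; exact: econg_mul0.
Qed.

Lemma sa_cstC c a : sa_mul (sa_cst c) a = sa_mul a (sa_cst c).
Proof.
elim/quotW: a => s.
by rewrite -!pi_sa_mul; apply: econg_pi; exact: econg_cstC.
Qed.

Lemma sa_mulr1 : right_id (sa_cst 1) sa_mul.
Proof. by move=> a; rewrite -sa_cstC sa_mul1. Qed.

Lemma sa_mulDl : left_distributive sa_mul sa_add.
Proof.
elim/quotW=> s; elim/quotW=> t; elim/quotW=> w.
rewrite -!(pi_sa_add, pi_sa_mul).
by apply: econg_pi; exact: econg_mulDl.
Qed.

Lemma sa_mulDr : right_distributive sa_mul sa_add.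
Proof.
elim/quotW=> s; elim/quotW=> t; elim/quotW=> w.
rewrite -!(pi_sa_add, pi_sa_mul).
by apply: econg_pi; exact: econg_mulDr.
Qed.

Lemma sa_cstD c d : sa_add (sa_cst c) (sa_cst d) = sa_cst (c + d).
Proof. by rewrite -pi_sa_add; apply: econg_pi; exact: econg_fun. Qed.

Lemma sa_cstM c d : sa_mul (sa_cst c) (sa_cst d) = sa_cst (c * d).
Proof. by rewrite -pi_sa_mul; apply: econg_pi; exact: econg_fun. Qed.

Lemma sa_addN : left_inverse (sa_cst 0) sa_opp sa_add.
Proof.
move=> a; rewrite /sa_opp -[X in sa_add _ X]sa_mul1 -sa_mulDl sa_cstD.
by rewrite addNr sa_mul0.
Qed.

(* The algebra acts on functions K -> K, with X_0 acting by multiplication,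
   (X_+ h) u = rho u * h (u - eps) and (X_- h) u = h (u + eps); hence it is
   nontrivial. *)
Fixpoint eact (s : expr) (h : K -> K) (u : K) : K :=
  match s with
  | ecst c => c * h u
  | eX0 => u * h u
  | eXp => rho u * h (u - eps)
  | eXm => h (u + eps)
  | eshift _ _ => efun s u * h u
  | eadd s1 s2 => eact s1 h u + eact s2 h u
  | emul s1 s2 => eact s1 (eact s2 h) u
  end.

Lemma eactD s h k u :
  eact s (fun v => h v + k v) u = eact s h u + eact s k u.
Proof.
elim: s h k u => [c||||g r|s IHs t IHt|s IHs t IHt] h k u //=;
  rewrite ?mulrDr ?IHs ?IHt //; first by rewrite addrACA.
rewrite -IHs; congr (eact s _ u); apply/funext => v; exact: IHt.
Qed.

Lemma eactZ s c h u : eact s (fun v => c * h v) u = c * eact s h u.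
Proof.
elim: s h u => [d||||g r|s IHs t IHt|s IHs t IHt] h u //=;
  rewrite ?(mulrCA _ c) ?IHs ?IHt ?mulrDr //.
rewrite -IHs; congr (eact s _ u); apply/funext => v; exact: IHt.
Qed.

Lemma eact_fun s h u : no_Xpm s -> eact s h u = efun s u * h u.
Proof.
elim: s h u => [c||||g r|s IHs t IHt|s IHs t IHt] h u //= /andP[ns nt].
  by rewrite IHs// IHt// mulrDl.
by rewrite IHs// IHt// mulrA.
Qed.

Lemma eact_econg s t : econg s t -> eact s = eact t.
Proof.
elim=> {s t} //=.
- by move=> s t w _ -> _ ->.
- by move=> s s' t t' _ es _ et; apply/funext=> h; apply/funext=> u /=;
    rewrite es et.
- by move=> s s' t t' _ es _ et; apply/funext=> h; apply/funext=> u /=;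
    rewrite es et.
- by move=> s t w; apply/funext=> h; apply/funext=> u /=; rewrite addrA.
- by move=> s t; apply/funext=> h; apply/funext=> u /=; rewrite addrC.
- by move=> s; apply/funext=> h; apply/funext=> u /=; rewrite mul0r add0r.
- by move=> s; apply/funext=> h; apply/funext=> u /=; rewrite mul1r.
- by move=> s; apply/funext=> h; apply/funext=> u /=; rewrite !mul0r.
- by move=> s t w; apply/funext=> h; apply/funext=> u /=; rewrite eactD.
- by move=> c s; apply/funext=> h; apply/funext=> u /=; rewrite eactZ.
- move=> s t ns nt st; apply/funext=> h; apply/funext=> u.
  by rewrite !eact_fun// st.
- apply/funext=> h; apply/funext=> u /=.
  by rewrite mulN1r mulrCA -mulrBr -mulrBl subKr mulrCA.
- apply/funext=> h; apply/funext=> u /=.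
  by rewrite mulN1r -mulrBl opprD addrA subrr add0r.
- move=> g r; apply/funext=> h; apply/funext=> u /=.
  rewrite mulrCA; congr (_ * (_ * _)).
  by rewrite rmorphD mulrDl mul1r addrACA addNr addr0.
- move=> g r; apply/funext=> h; apply/funext=> u /=; congr (_ * _).
  by rewrite rmorphB mulrBl mul1r addrACA subrr addr0.
- apply/funext=> h; apply/funext=> u /=.
  by rewrite mul0r addr0 subrK.
- apply/funext=> h; apply/funext=> u /=.
  by rewrite mul1r addrK.
Qed.

Lemma sa_1_neq0 : sa_cst 1 != sa_cst 0.
Proof.
apply/eqP => /econgP/asboolP/eact_econg/(congr1 (fun a => a (fun=> 1) 0)) /=.
by rewrite mul1r mul0r; apply/eqP; exact: oner_neq0.
Qed.

HB.instance Definition _ :=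
  GRing.isZmodule.Build shift_alg sa_addA sa_addC sa_add0 sa_addN.
HB.instance Definition _ := GRing.Zmodule_isNzRing.Build shift_alg
  sa_mulA sa_mul1 sa_mulr1 sa_mulDl sa_mulDr sa_1_neq0.

Definition sa_scale (c : K) (a : shift_alg) : shift_alg := sa_cst c * a.

Lemma sa_scaleA c d a : sa_scale c (sa_scale d a) = sa_scale (c * d) a.
Proof. by rewrite /sa_scale mulrA [_ * sa_cst d]sa_cstM. Qed.

Lemma sa_scale1 : left_id 1 sa_scale.
Proof. exact: sa_mul1. Qed.

Lemma sa_scaleDr : right_distributive sa_scale +%R.
Proof. by move=> c a b; exact: mulrDr. Qed.

Lemma sa_scaleDl a : {morph sa_scale^~ a : c d / c + d}.
Proof. by move=> c d; rewrite /sa_scale -mulrDl [_ + sa_cst d]sa_cstD. Qed.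

HB.instance Definition _ := GRing.Zmodule_isLmodule.Build K shift_alg
  sa_scaleA sa_scale1 sa_scaleDr sa_scaleDl.

Lemma sa_scaleAl (c : K) (a b : shift_alg) : c *: (a * b) = (c *: a) * b.
Proof. exact: mulrA. Qed.

HB.instance Definition _ :=
  GRing.Lmodule_isLalgebra.Build K shift_alg sa_scaleAl.

Lemma sa_scaleAr (c : K) (a b : shift_alg) : c *: (a * b) = a * (c *: b).
Proof. by rewrite /GRing.scale/= /sa_scale mulrA [_ * a]sa_cstC mulrA. Qed.

HB.instance Definition _ :=
  GRing.Lalgebra_isAlgebra.Build K shift_alg sa_scaleAr.

Definition X0 : shift_alg := \pi_shift_alg eX0.
Definition Xp : shift_alg := \pi_shift_alg eXp.
Definition Xm : shift_alg := \pi_shift_alg eXm.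

(* sigma_j (X_0 + r eps) *)
Definition Xsig (j : J) (r : int) : shift_alg :=
  \pi_shift_alg (eshift (Some j) r).

(* a = f (X_0), with f in the algebra of functions generated by the identity
   and the shifts of rho and of the sigma_j *)
Definition function_of_X0 (f : K -> K) (a : shift_alg) : Prop :=
  exists s : expr, [/\ no_Xpm s, efun s =1 f & a = \pi_shift_alg s].

End ShiftAlgebra.

Arguments X0 {K J rho sigma eps}.
Arguments Xp {K J rho sigma eps}.
Arguments Xm {K J rho sigma eps}.
Arguments Xsig {K J rho sigma eps}.
Arguments function_of_X0 {K J rho sigma eps}.

Section Specializations.
Variable K : fieldType.

(* A(rho, eps) *)
Definition alg (rho : K -> K) (eps : K) : algType K :=
  shift_alg rho (of_void (K -> K)) eps.

(* A(rho, sigma_+, sigma_-, eps); sigma_+ has index true, sigma_- false *)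
Definition enlarged_alg (rho sp sm : K -> K) (eps : K) : algType K :=
  shift_alg rho (fun b : bool => if b then sp else sm) eps.

End Specializations.

(* Locally the sum of a convergent power series; used with K = C. *)
Definition analytic_fun (K : numFieldType) (f : K -> K) : Prop :=
  forall z0 : K, exists a : nat -> K,
    \forall z \near z0, series (fun n => a n * (z - z0) ^+ n) @ \oo --> f z.

Section ComplexData.
Variable R : realType.

Local Notation C := R[i].

Definition real_function (f : C -> C) : Prop :=
  forall x : R, f x%:C \is Num.real.

(* The order of R[i] is partial: 0 < z means that z is real and positive. *)
Definition pos_set (rho : C -> C) : set R := [set u | 0 < rho u%:C].

Definition surface (rho : C -> C) : set (R * R * R) :=
  [set p | (p.1.1 ^+ 2 + p.1.2 ^+ 2)%:C = rho p.2%:C].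

(* For a nonempty interval I, sup I and inf I are its end points when I is
   bounded. The length of the empty set is 0. *)
Definition interval_length (I : set R) : \bar R :=
  if `[< has_lbound I /\ has_ubound I >] then (sup I - inf I)%:E else +oo%E.

(* Conjugation is defined for real eps. It maps f (X_0) to g (X_0) with
   g u = (f u^* )^*, the analytic function which agrees with u |-> (f u)^* on
   the real line. On an enlarged algebra it need not exist, as g may fail to
   be generated by the sigma_j. *)
Definition is_conjugation (J : Type) (rho : C -> C) (sigma : J -> C -> C)
    (eps : C) (dag : shift_alg rho sigma eps -> shift_alg rho sigma eps) :
    Prop :=
  [/\ forall a b, dag (a + b) = dag a + dag b,
      forall (c : C) a, dag (c *: a) = c^* *: dag a,
      forall a b, dag (a * b) = dag b * dag a,
      [/\ dag X0 = X0, dag Xp = Xm & dag Xm = Xp]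
    & forall f a, function_of_X0 f a ->
        function_of_X0 (fun u => (f u^*)^*) (dag a)].

Section Mapping.
Variables (rho1 rho2 sp sm : C -> C) (eps1 eps2 lam : C).

Definition map_data : Prop :=
  [/\ [/\ analytic_fun rho1, analytic_fun rho2, analytic_fun sp
          & analytic_fun sm],
      forall u, sp u != 0,
      forall u, sm u != 0,
      eps2 != 0
    & forall u, rho1 (eps1 / eps2 * u + lam) = rho2 u * sp u * sm u].

Variable phi :
  {lrmorphism alg rho1 eps1 -> enlarged_alg rho2 sp sm eps2}.

(* X_0 |-> (eps1 / eps2) Y_0 + lam determines the image of each function
   f (X_0), in particular of rho1 (X_0 + r eps1): it is f (phi X_0). *)
Definition is_the_map : Prop :=
  [/\ phi X0 = (eps1 / eps2) *: X0 + lam%:A,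
      phi Xp = Xsig true 0 * Xp,
      phi Xm = Xm * Xsig false 0
    & forall f a, function_of_X0 f a ->
        function_of_X0 (fun u => f (eps1 / eps2 * u + lam)) (phi a)].

Definition preserves_conjugation : Prop :=
  exists dag1 dag2, [/\ is_conjugation dag1, is_conjugation dag2
    & forall a, phi (dag1 a) = dag2 (phi a)].

End Mapping.
End ComplexData.

Definition homeomorphic (T U : topologicalType) (A : set T) (B : set U) :
    Prop :=
  exists (f : T -> U) (g : U -> T),
    [/\ {within A, continuous f}, {within B, continuous g},
        forall x, A x -> B (f x) /\ g (f x) = x
      & forall y, B y -> A (g y) /\ f (g y) = y].

(* Main.v *)
Require Import Defs.
From HB Require Import structures.
From mathcomp Require Import all_boot all_order all_algebra.
From mathcomp Require Import complex.
From mathcomp Require Import all_classical all_reals all_analysis.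
From mathcomp Require Import ring.
Set Implicit Arguments.
Unset Strict Implicit.
Unset Printing Implicit Defensive.
Import Order.TTheory GRing.Theory Num.Theory.
Import numFieldNormedType.Exports.

Local Open Scope classical_set_scope.
Local Open Scope ring_scope.
Local Open Scope complex_scope.

(* Every element of A(rho, eps) is a sum of terms f(X_0) X_+^n and
   g(X_0) X_-^n. The algebra acts on functions h by
     (X_+ h)(u) = wp(u) h(u - eps),  (X_- h)(u) = wm(u) h(u + eps)
   whenever wp(u) wm(u - eps) = rho(u), and applying an element to delta
   functions recovers f (weights wp = 1, wm = rho(. + eps)) and g (weights
   wp = rho, wm = 1). As sigma_+ and sigma_- do not vanish, the same extraction
   in the target algebra gives injectivity.
   Preservation of conjugation is compared on the generators; for the converse,
   conj (sigma_+) = sigma_- on the real line extends to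
   conj (sigma_+ (conj u)) = sigma_- u by the identity theorem, and then the
   relations of the enlarged algebra are stable under conjugation. On the real
   line sigma_+ sigma_- = |sigma_+|^2 > 0, so scaling x, y by |sigma_+| and z
   affinely identifies the two surfaces, and the positivity sets are affine
   images of each other.
   The map is not surjective for rho_1 = rho_2 = 0, sigma_+ = exp, sigma_- = 1:
   the image contains only polynomials in Y_0. *)

(** * Functions of X_0, translations and normal forms *)

Section ShiftAlgebraTheory.
Variables (K : fieldType) (J : Type).
Variables (rho : K -> K) (sigma : J -> K -> K) (eps : K).

Local Notation expr := (expr K J).
Local Notation A := (shift_alg rho sigma eps).
Local Notation econg := (econg rho sigma eps).
Local Notation efun := (efun rho sigma eps).
Local Notation fX0 := (@function_of_X0 K J rho sigma eps).

Definition cls (s : expr) : A := (\pi_A s)%qT.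

Lemma cls_surj (a : A) : exists s, a = cls s.
Proof. by exists (repr a); rewrite /cls reprK. Qed.

Lemma cls_repr (a : A) : cls (repr a) = a.
Proof. by rewrite /cls reprK. Qed.

Lemma cls_eqP s t : cls s = cls t <-> econg s t.
Proof. by split=> [/econgP/asboolP|/econg_pi]. Qed.

Lemma clsD s t : cls (eadd s t) = cls s + cls t.
Proof. exact: pi_sa_add. Qed.

Lemma clsM s t : cls (emul s t) = cls s * cls t.
Proof. exact: pi_sa_mul. Qed.

Lemma cls_cst c : cls (ecst c) = c%:A.
Proof.
by rewrite /GRing.scale/= /sa_scale mulr1.
Qed.

Lemma cls_fun s t : no_Xpm s -> no_Xpm t -> efun s =1 efun t -> cls s = cls t.
Proof. by move=> ns nt st; apply/cls_eqP; exact: econg_fun. Qed.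

Lemma function_of_X0_cls s : no_Xpm s -> fX0 (efun s) (cls s).
Proof. by move=> ns; exists s. Qed.

(** By [econg_fun] an element is determined by the function it denotes, so most identities below
    reduce to comparing values of functions. *)
Lemma function_of_X0_inj f g a b : f =1 g -> fX0 f a -> fX0 g b -> a = b.
Proof.
move=> fg [s [ns sf ->]] [t [nt tg ->]]; apply: cls_fun => // u.
by rewrite sf tg fg.
Qed.

Lemma eq_function_of_X0 f g a : f =1 g -> fX0 f a -> fX0 g a.
Proof. by move=> fg [s [ns sf ->]]; exists s; split=> // u; rewrite sf. Qed.

Lemma function_of_X0_cst c : fX0 (fun=> c) c%:A.
Proof. by rewrite -cls_cst; exists (ecst c). Qed.

Lemma function_of_X0_0 : fX0 (fun=> 0) 0.
Proof. by rewrite -(scale0r (1 : A)); exact: function_of_X0_cst. Qed.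

Lemma function_of_X0_X0 : fX0 id X0.
Proof. by exists eX0. Qed.

Lemma function_of_X0_rho r :
  fX0 (fun u => rho (u + r%:~R * eps)) (cls (eshift None r)).
Proof. by exists (eshift None r). Qed.

Lemma function_of_X0_sig j r :
  fX0 (fun u => sigma j (u + r%:~R * eps)) (Xsig j r).
Proof. by exists (eshift (Some j) r). Qed.

Lemma function_of_X0_sig0 j : fX0 (sigma j) (Xsig j 0).
Proof.
apply: eq_function_of_X0 (function_of_X0_sig j 0) => u.
by rewrite mul0r addr0.
Qed.

Lemma function_of_X0D f g a b :
  fX0 f a -> fX0 g b -> fX0 (fun u => f u + g u) (a + b).
Proof.
move=> [s [ns sf ->]] [t [nt tg ->]]; exists (eadd s t).
by split=> [|u|] /=; rewrite ?ns ?sf ?tg// [RHS]clsD.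
Qed.

Lemma function_of_X0M f g a b :
  fX0 f a -> fX0 g b -> fX0 (fun u => f u * g u) (a * b).
Proof.
move=> [s [ns sf ->]] [t [nt tg ->]]; exists (emul s t).
by split=> [|u|] /=; rewrite ?ns ?sf ?tg// [RHS]clsM.
Qed.

Lemma function_of_X0Z c f a : fX0 f a -> fX0 (fun u => c * f u) (c *: a).
Proof.
move=> fa; rewrite -(mul1r a) scalerAl; apply: function_of_X0M fa.
exact: function_of_X0_cst.
Qed.

Lemma function_of_X0C f g a b : fX0 f a -> fX0 g b -> a * b = b * a.
Proof.
move=> fa gb; apply: function_of_X0_inj (function_of_X0M fa gb)
  (function_of_X0M gb fa) => u; exact: mulrC.
Qed.

(** Translating the expression, and not just its function, keeps the result among the generated
    functions: for the symbols only the index moves. It is applied to expressions without [eXp] and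
    [eXm], so these are left alone. *)
Fixpoint etranslate (r : int) (s : expr) : expr :=
  match s with
  | eX0 => eadd eX0 (ecst (r%:~R * eps))
  | eshift g k => eshift g (k + r)
  | eadd s t => eadd (etranslate r s) (etranslate r t)
  | emul s t => emul (etranslate r s) (etranslate r t)
  | _ => s
  end.

Lemma no_Xpm_translate r s : no_Xpm (etranslate r s) = no_Xpm s.
Proof. by elim: s => //= s -> t ->. Qed.

Lemma efun_translate r s u : efun (etranslate r s) u = efun s (u + r%:~R * eps).
Proof.
elim: s => //= [g k|s -> t ->|s -> t ->]//.
by rewrite rmorphD mulrDl addrAC addrA.
Qed.

Lemma X0_Xp : X0 * Xp = Xp * (X0 + eps%:A) :> A.
Proof.
have /cls_eqP := econg_comm_p rho sigma eps.
rewrite clsD !clsM !cls_cst mulrDr -!scalerAl !mul1r scaleN1r => /eqP.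
by rewrite subr_eq addrC -scalerAr mulr1 => /eqP.
Qed.

Lemma X0_Xm : X0 * Xm = Xm * (X0 - eps%:A) :> A.
Proof.
have /cls_eqP := econg_comm_m rho sigma eps.
rewrite clsD !clsM !cls_cst mulrBr -!scalerAl !mul1r scaleN1r => /eqP.
by rewrite subr_eq addrC scaleNr -scalerAr mulr1 => /eqP.
Qed.

Lemma Xp_Xm : Xp * Xm = cls (eshift None 0).
Proof. by rewrite -clsM; apply/cls_eqP; exact: econg_pm. Qed.

Lemma Xm_Xp : Xm * Xp = cls (eshift None 1).
Proof. by rewrite -clsM; apply/cls_eqP; exact: econg_mp. Qed.

(** The relations settle the generators; translation respects sums and products, so induction
    carries the rule to every function of [X0]. *)
Lemma cls_mul_Xp s : no_Xpm s -> cls s * Xp = Xp * cls (etranslate 1 s).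
Proof.
elim: s => //= [c _|_|g r _|s IHs t IHt /andP[ns nt]|s IHs t IHt /andP[ns nt]].
- by rewrite cls_cst -scalerAl -scalerAr mulr1 mul1r.
- by rewrite clsD cls_cst mul1r; exact: X0_Xp.
- by rewrite -!clsM; apply/cls_eqP; exact: econg_shift_p.
- by rewrite !clsD mulrDl mulrDr IHs// IHt.
- by rewrite !clsM -mulrA IHt// mulrA IHs// mulrA.
Qed.

Lemma cls_mul_Xm s : no_Xpm s -> cls s * Xm = Xm * cls (etranslate (-1) s).
Proof.
elim: s => //= [c _|_|g r _|s IHs t IHt /andP[ns nt]|s IHs t IHt /andP[ns nt]].
- by rewrite cls_cst -scalerAl -scalerAr mulr1 mul1r.
- by rewrite clsD cls_cst rmorphN mulN1r scaleNr; exact: X0_Xm.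
- by rewrite -!clsM; apply/cls_eqP; exact: econg_shift_m.
- by rewrite !clsD mulrDl mulrDr IHs// IHt.
- by rewrite !clsM -mulrA IHt// mulrA IHs// mulrA.
Qed.

Lemma function_of_X0_translate r f a : fX0 f a ->
  exists b, fX0 (fun u => f (u + r%:~R * eps)) b.
Proof.
move=> [s [ns sf _]]; exists (cls (etranslate r s)), (etranslate r s).
by split=> [|u|]; rewrite ?no_Xpm_translate// efun_translate sf.
Qed.

Lemma function_of_X0_mul_Xp f a b :
  fX0 f a -> fX0 (fun u => f (u + eps)) b -> a * Xp = Xp * b.
Proof.
move=> [s [ns sf ->]] [t [nt tf ->]]; rewrite cls_mul_Xp//; congr (_ * _).
apply: cls_fun => [||u]; rewrite ?no_Xpm_translate//.
by rewrite efun_translate sf tf mul1r.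
Qed.

Lemma function_of_X0_mul_Xm f a b :
  fX0 f a -> fX0 (fun u => f (u - eps)) b -> a * Xm = Xm * b.
Proof.
move=> [s [ns sf ->]] [t [nt tf ->]]; rewrite cls_mul_Xm//; congr (_ * _).
apply: cls_fun => [||u]; rewrite ?no_Xpm_translate//.
by rewrite efun_translate sf tf rmorphN mulN1r.
Qed.

(** The commutation rule is used backwards: translating by [- eps] first lets a coefficient pass to
    the left of [Xp], where normal forms keep it. *)
Lemma Xp_mul_function_of_X0 f a : fX0 f a ->
  exists2 b, fX0 (fun u => f (u - eps)) b & Xp * a = b * Xp.
Proof.
move=> fa; have [b fb] := function_of_X0_translate (-1) fa.
have {}fb : fX0 (fun u => f (u - eps)) b.
  by apply: eq_function_of_X0 fb => u; rewrite rmorphN mulN1r.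
exists b => //; symmetry; apply: function_of_X0_mul_Xp fb _.
by apply: eq_function_of_X0 fa => u; rewrite addrK.
Qed.

Lemma Xm_mul_function_of_X0 f a : fX0 f a ->
  exists2 b, fX0 (fun u => f (u + eps)) b & Xm * a = b * Xm.
Proof.
move=> fa; have [b fb] := function_of_X0_translate 1 fa.
have {}fb : fX0 (fun u => f (u + eps)) b.
  by apply: eq_function_of_X0 fb => u; rewrite mul1r.
exists b => //; symmetry; apply: function_of_X0_mul_Xm fb _.
by apply: eq_function_of_X0 fa => u; rewrite subrK.
Qed.

(** * Homomorphisms defined by the images of the generators *)

Section Fold.
Variables (B : algType K) (b0 bp bm : B) (bs : option J -> int -> B).

Fixpoint efold (s : expr) : B :=
  match s with
  | ecst c => c%:A
  | eX0 => b0
  | eXp => bp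
  | eXm => bm
  | eshift g r => bs g r
  | eadd s t => efold s + efold t
  | emul s t => efold s * efold t
  end.

Hypothesis efold_fun : forall s t,
  no_Xpm s -> no_Xpm t -> efun s =1 efun t -> efold s = efold t.
Hypothesis comm_p : b0 * bp - bp * b0 = eps *: bp.
Hypothesis comm_m : b0 * bm - bm * b0 = - eps *: bm.
Hypothesis shift_p : forall g r, bs g r * bp = bp * bs g (r + 1).
Hypothesis shift_m : forall g r, bs g r * bm = bm * bs g (r - 1).
Hypothesis mul_pm : bp * bm = bs None 0.
Hypothesis mul_mp : bm * bp = bs None 1.

(** The algebra laws hold in [B], and the other relations are the section hypotheses. [econg_fun]
    ranges over all expressions in [eX0] and the symbols, so its image [efold_fun] is assumed as a
    whole. *)
Lemma efold_econg s t : econg s t -> efold s = efold t.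
Proof.
elim=> {s t} //=.
- by move=> s t w _ -> _ ->.
- by move=> s s' t t' _ -> _ ->.
- by move=> s s' t t' _ -> _ ->.
- by move=> *; rewrite addrA.
- by move=> *; rewrite addrC.
- by move=> *; rewrite scale0r add0r.
- by move=> *; rewrite mulrA.
- by move=> *; rewrite scale1r mul1r.
- by move=> *; rewrite scale0r mul0r.
- by move=> *; rewrite mulrDl.
- by move=> *; rewrite mulrDr.
- by move=> *; rewrite -scalerAl -scalerAr mulr1 mul1r.
- by rewrite -scalerAl mul1r scaleN1r comm_p -scalerAl mul1r.
- by rewrite -scalerAl mul1r scaleN1r comm_m -scalerAl mul1r.
Qed.

(** The universal property. The map folds a chosen representative, and [efold_econg] makes the
    choice harmless. *)
Lemma shift_alg_hom : exists phi : {lrmorphism A -> B},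
  forall s, phi (cls s) = efold s.
Proof.
pose f (a : A) := efold (repr a).
have fE s : f (cls s) = efold s.
  by apply: efold_econg; apply/cls_eqP; rewrite cls_repr.
have f_lin : linear f.
  move=> c a b; have [s ->] := cls_surj a; have [t ->] := cls_surj b.
  have -> : c *: cls s = cls (emul (ecst c) s).
    by rewrite clsM cls_cst -scalerAl mul1r.
  by rewrite -clsD !fE /= -scalerAl mul1r.
have f_mul : monoid_morphism f.
  split=> [|a b]; first by rewrite -(scale1r (1 : A)) -cls_cst fE /= scale1r.
  have [s ->] := cls_surj a; have [t ->] := cls_surj b.
  by rewrite -clsM !fE.
pose fL := GRing.isLinear.Build K A B _ f f_lin.
pose fM := GRing.isMonoidMorphism.Build A B f f_mul.
pose phi : {lrmorphism A -> B} := HB.pack f fL fM.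
by exists phi.
Qed.

End Fold.

(** * Weighted shift representations *)

Section WeightedShift.
Variables wp wm : K -> K.

(** [eact] is the case [wp = rho], [wm = 1]. The relations only constrain [wp u * wm (u - eps)], so
    the factor [rho] can be put on either generator. *)
Fixpoint wact (s : expr) (h : K -> K) (u : K) : K :=
  match s with
  | ecst c => c * h u
  | eX0 => u * h u
  | eXp => wp u * h (u - eps)
  | eXm => wm u * h (u + eps)
  | eshift _ _ => efun s u * h u
  | eadd s1 s2 => wact s1 h u + wact s2 h u
  | emul s1 s2 => wact s1 (wact s2 h) u
  end.

Lemma wactD s h k u :
  wact s (fun v => h v + k v) u = wact s h u + wact s k u.
Proof.
elim: s h k u => [c||||g r|s IHs t IHt|s IHs t IHt] h k u //=;
  rewrite ?mulrDr ?IHs ?IHt //; first by rewrite addrACA.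
rewrite -IHs; congr (wact s _ u); apply/funext => v; exact: IHt.
Qed.

Lemma wactZ s c h u : wact s (fun v => c * h v) u = c * wact s h u.
Proof.
elim: s h u => [d||||g r|s IHs t IHt|s IHs t IHt] h u //=;
  rewrite ?(mulrCA _ c) ?IHs ?IHt ?mulrDr //.
rewrite -IHs; congr (wact s _ u); apply/funext => v; exact: IHt.
Qed.

Lemma wact_fun s h u : no_Xpm s -> wact s h u = efun s u * h u.
Proof.
elim: s h u => [c||||g r|s IHs t IHt|s IHs t IHt] h u //= /andP[ns nt].
  by rewrite IHs// IHt// mulrDl.
by rewrite IHs// IHt// mulrA.
Qed.

Hypothesis w_rho : forall u, wp u * wm (u - eps) = rho u.

Lemma wact_econg s t : econg s t -> wact s = wact t.
Proof.
elim=> {s t} //=.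
- by move=> s t w _ -> _ ->.
- by move=> s s' t t' _ es _ et; apply/funext=> h; apply/funext=> u /=;
    rewrite es et.
- by move=> s s' t t' _ es _ et; apply/funext=> h; apply/funext=> u /=;
    rewrite es et.
- by move=> s t w; apply/funext=> h; apply/funext=> u /=; rewrite addrA.
- by move=> s t; apply/funext=> h; apply/funext=> u /=; rewrite addrC.
- by move=> s; apply/funext=> h; apply/funext=> u /=; rewrite mul0r add0r.
- by move=> s; apply/funext=> h; apply/funext=> u /=; rewrite mul1r.
- by move=> s; apply/funext=> h; apply/funext=> u /=; rewrite !mul0r.
- by move=> s t w; apply/funext=> h; apply/funext=> u /=; rewrite wactD.
- by move=> c s; apply/funext=> h; apply/funext=> u /=; rewrite wactZ.
- move=> s t ns nt st; apply/funext=> h; apply/funext=> u.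
  by rewrite !wact_fun// st.
- by apply/funext=> h; apply/funext=> u /=; ring.
- by apply/funext=> h; apply/funext=> u /=; ring.
- move=> g r; apply/funext=> h; apply/funext=> u /=.
  by rewrite rmorphD /= mulrDl mul1r addrACA addNr addr0 mulrCA.
- move=> g r; apply/funext=> h; apply/funext=> u /=.
  by rewrite rmorphB /= mulrBl mul1r addrACA subrr addr0 mulrCA.
- by apply/funext=> h;
  apply/funext=> u /=; rewrite mulrA w_rho subrK mul0r addr0.
- apply/funext=> h; apply/funext=> u /=.
  by rewrite mulrA addrK mul1r -w_rho addrK (mulrC (wm u)).
Qed.

Definition sact (a : A) := wact (repr a).

Lemma sact_cls s : sact (cls s) = wact s.
Proof. by apply: wact_econg; apply/cls_eqP; rewrite cls_repr. Qed.

Lemma sactD a b h u : sact (a + b) h u = sact a h u + sact b h u.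
Proof.
have [s ->] := cls_surj a; have [t ->] := cls_surj b.
by rewrite -clsD !sact_cls.
Qed.

Lemma sactM a b h : sact (a * b) h = sact a (sact b h).
Proof.
have [s ->] := cls_surj a; have [t ->] := cls_surj b.
by rewrite -clsM !sact_cls.
Qed.

Lemma sact_fun f a h u : fX0 f a -> sact a h u = f u * h u.
Proof. by move=> [s [ns sf ->]]; rewrite sact_cls wact_fun// sf. Qed.

Lemma sact0 h u : sact 0 h u = 0.
Proof. by rewrite (sact_fun _ _ function_of_X0_0) mul0r. Qed.

Lemma sact1 h u : sact 1 h u = h u.
Proof.
by rewrite -(scale1r (1 : A)) (sact_fun _ _ (function_of_X0_cst _)) mul1r.
Qed.

Lemma sactXp h u : sact Xp h u = wp u * h (u - eps).
Proof. by rewrite [Xp]/(cls eXp) sact_cls. Qed.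

Lemma sactXm h u : sact Xm h u = wm u * h (u + eps).
Proof. by rewrite [Xm]/(cls eXm) sact_cls. Qed.

Lemma sact_sum I (r : seq I) (P : pred I) (F : I -> A) h u :
  sact (\sum_(i <- r | P i) F i) h u = \sum_(i <- r | P i) sact (F i) h u.
Proof.
elim/big_rec2: _ => [|i y x _ <-]; first exact: sact0.
by rewrite sactD.
Qed.

(** Each factor multiplies by [w] at the current point and then steps by [d], so the weights
    accumulate along the orbit of [u]. *)
Lemma sactX b w d n h u : (forall h u, sact b h u = w u * h (u + d)) ->
  sact (b ^+ n) h u = (\prod_(i < n) w (u + d *+ i)) * h (u + d *+ n).
Proof.
move=> bE; elim: n u => [|n IHn] u.
  by rewrite expr0 sact1 big_ord0 mul1r addr0.
rewrite exprS sactM bE IHn big_ord_recl addr0 mulrA mulrS addrA.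
by congr (_ * _ * _); apply: eq_bigr => i _; rewrite mulrS addrA.
Qed.

End WeightedShift.

(** The second sum starts at the first power of [Xm], so that the degree 0 coefficient occurs only
    once. Coefficients may vanish, which allows one bound for both sums. *)
Definition normal_form (N : nat) (a : A) : Prop :=
  exists (f g : nat -> K -> K) (F G : nat -> A),
    [/\ forall n, fX0 (f n) (F n), forall n, fX0 (g n) (G n)
      & a = \sum_(n < N) F n * Xp ^+ n + \sum_(n < N) G n * Xm ^+ n.+1].

Lemma normal_form_widen N M a :
  (N <= M)%N -> normal_form N a -> normal_form M a.
Proof.
move=> NM [f [g [F [G [fF gG ->]]]]].
exists (fun n => if (n < N)%N then f n else fun=> 0).
exists (fun n => if (n < N)%N then g n else fun=> 0).
exists (fun n => if (n < N)%N then F n else 0).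
exists (fun n => if (n < N)%N then G n else 0).
split=> [n|n|]; try by case: ifP => // _; exact: function_of_X0_0.
congr (_ + _).
  rewrite (big_ord_widen M (fun n => F n * Xp ^+ n) NM) big_mkcond.
  by apply: eq_bigr => i _; case: ifP => //; rewrite mul0r.
rewrite (big_ord_widen M (fun n => G n * Xm ^+ n.+1) NM) big_mkcond.
by apply: eq_bigr => i _; case: ifP => //; rewrite mul0r.
Qed.

Lemma normal_formD N a b :
  normal_form N a -> normal_form N b -> normal_form N (a + b).
Proof.
move=> [f [g [F [G [fF gG ->]]]]] [f' [g' [F' [G' [fF' gG' ->]]]]].
exists (fun n u => f n u + f' n u), (fun n u => g n u + g' n u).
exists (fun n => F n + F' n), (fun n => G n + G' n).
split=> [n|n|]; [exact: function_of_X0D| exact: function_of_X0D|].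
rewrite addrACA -!big_split /=.
by apply: eq_bigr => i _; rewrite !mulrDl.
Qed.

Let has_nf a := exists N, normal_form N a.

Let has_nfD a b : has_nf a -> has_nf b -> has_nf (a + b).
Proof.
move=> [N aN] [M bM]; exists (maxn N M).
by apply: normal_formD; [apply: normal_form_widen aN; rewrite leq_maxl|
                         apply: normal_form_widen bM; rewrite leq_maxr].
Qed.

Let has_nf0 : has_nf 0.
Proof.
exists 0%N, (fun _ _ => 0), (fun _ _ => 0), (fun=> 0), (fun=> 0).
by split=> [n|n|]; rewrite ?big_ord0 ?addr0//; exact: function_of_X0_0.
Qed.

Let has_nf_Xp f a n : fX0 f a -> has_nf (a * Xp ^+ n).
Proof.
move=> fa; exists n.+1.
exists (fun m => if m == n then f else fun=> 0), (fun _ _ => 0).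
exists (fun m => if m == n then a else 0), (fun=> 0).
split=> [m|m|]; [case: ifP => // _|exact: function_of_X0_0|].
  exact: function_of_X0_0.
rewrite [X in _ + X]big1 => [|i _]; last by rewrite mul0r.
rewrite addr0 big_ord_recr /= eqxx big1 ?add0r// => i _.
by rewrite ltn_eqF// mul0r.
Qed.

Let has_nf_Xm f a n : fX0 f a -> has_nf (a * Xm ^+ n).
Proof.
case: n => [|n] fa; first by rewrite expr0 -(expr0 Xp); exact: has_nf_Xp fa.
exists n.+1.
exists (fun _ _ => 0), (fun m => if m == n then f else fun=> 0).
exists (fun=> 0), (fun m => if m == n then a else 0).
split=> [m|m|]; [exact: function_of_X0_0|case: ifP => // _|].
  exact: function_of_X0_0.
rewrite big1 => [|i _]; last by rewrite mul0r.
rewrite add0r big_ord_recr /= eqxx big1 ?add0r// => i _.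
by rewrite ltn_eqF// mul0r.
Qed.

(** Sums in normal form include 1 and are stable under left multiplication by each generator:
    coefficients move left, and an adjacent pair [Xp * Xm] or [Xm * Xp] collapses to a function of
    [X0]. *)
Lemma exists_normal_form a : exists N, normal_form N a.
Proof.
suff H s b : has_nf b -> has_nf (cls s * b).
  have [s ->] := cls_surj a; rewrite -[cls s]mulr1; apply: H.
  rewrite -[1]mulr1 -{2}(expr0 Xp); apply: (@has_nf_Xp (fun=> 1)).
  by rewrite -(scale1r (1 : A)); exact: function_of_X0_cst.
have reduce x : (forall f c n, fX0 f c -> has_nf (x * (c * Xp ^+ n))) ->
    (forall f c n, fX0 f c -> has_nf (x * (c * Xm ^+ n.+1))) ->
    forall b, has_nf b -> has_nf (x * b).
  move=> xp xm c [N [f [g [F [G [fF gG ->]]]]]]; rewrite mulrDr !mulr_sumr.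
  apply: has_nfD; elim/big_ind: _ => // i _; [exact: xp|exact: xm].
elim: s b => [c||||g r|s IHs t IHt|s IHs t IHt] b hb.
- apply: reduce hb => f d n fd; rewrite cls_cst mulrA.
    by apply: has_nf_Xp; apply: function_of_X0M fd; exact: function_of_X0_cst.
  by apply: has_nf_Xm; apply: function_of_X0M fd; exact: function_of_X0_cst.
- apply: reduce hb => f d n fd; rewrite mulrA.
    by apply: has_nf_Xp; apply: function_of_X0M fd; exact: function_of_X0_X0.
  by apply: has_nf_Xm; apply: function_of_X0M fd; exact: function_of_X0_X0.
- apply: reduce hb => f d n fd.
    have [e fe de] := Xp_mul_function_of_X0 fd.
    by rewrite mulrA [_ * d]de -mulrA -exprS; exact: has_nf_Xp fe.
  have [e fe de] := Xp_mul_function_of_X0 fd.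
  rewrite mulrA [_ * d]de -mulrA exprS (mulrA Xp) Xp_Xm mulrA.
  by apply: has_nf_Xm; apply: function_of_X0M fe _; exact: function_of_X0_rho.
- apply: reduce hb => f d n fd.
    have [e fe de] := Xm_mul_function_of_X0 fd.
    (* In degree 0 there is no [Xp] to cancel, and the extra [Xm] lands in the second sum. *)
    rewrite mulrA [_ * d]de -mulrA; case: n => [|n].
      by rewrite expr0 mulr1 -[Xm]expr1; exact: has_nf_Xm fe.
    rewrite exprS (mulrA Xm) Xm_Xp mulrA.
    by apply: has_nf_Xp; apply: function_of_X0M fe _; exact: function_of_X0_rho.
  have [e fe de] := Xm_mul_function_of_X0 fd.
  by rewrite mulrA [_ * d]de -mulrA -exprS; exact: has_nf_Xm fe.
- have fs := @function_of_X0_cls (eshift g r) isT.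
  apply: reduce hb => f d n fd; rewrite mulrA.
    by apply: has_nf_Xp; exact: function_of_X0M fs fd.
  by apply: has_nf_Xm; exact: function_of_X0M fs fd.
- by rewrite clsD mulrDl; apply: has_nfD; [exact: IHs|exact: IHt].
- by rewrite clsM -mulrA; apply: IHs; exact: IHt.
Qed.

End ShiftAlgebraTheory.

(** * Extraction of coefficients by delta functions *)

Section Coefficients.
Variables (K : numFieldType) (J : Type).
Variables (rho : K -> K) (sigma : J -> K -> K) (eps : K).
Variables wp wm : K -> K.
Hypothesis w_rho : forall u, wp u * wm (u - eps) = rho u.
Hypothesis eps_neq0 : eps != 0.

Local Notation A := (shift_alg rho sigma eps).
Local Notation act := (@sact K J rho sigma eps wp wm).

Let sact_term f (a b : A) w d n x u :
    function_of_X0 f a -> (forall h u, act b h u = w u * h (u + d)) ->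
  act (a * b ^+ n) (fun v => (v == x)%:R) u =
    f u * \prod_(i < n) w (u + d *+ i) * (u + d *+ n == x)%:R.
Proof.
move=> fa bE; rewrite sactM// (sact_fun w_rho _ _ fa).
by rewrite (sactX w_rho _ _ _ bE) mulrA.
Qed.

Let mulrn_eps_eq u m n : (u + eps *+ m == u + eps *+ n) = (m == n).
Proof.
rewrite (can_eq (addKr _)) -!(mulr_natr eps) (inj_eq (mulfI eps_neq0)).
exact: eqr_nat.
Qed.

Let mulrn_eps_eqN u m n : (u - eps *+ m == u - eps *+ n) = (m == n).
Proof.
by rewrite (can_eq (addKr _)) eqr_opp -(mulrn_eps_eq 0) !add0r.
Qed.

Let mulrn_eps_cross u m n :
  (u + eps *+ m == u - eps *+ n) = (m + n == 0)%N.
Proof.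
rewrite (can_eq (addKr _)) -subr_eq0 opprK -mulrnDr.
by rewrite -(mulrn_eps_eq 0) !add0r mulr0n.
Qed.

(** Since [eps] is nonzero, different powers move [u] to different points, so a delta function
    selects a single term. [P] and [M] are general because they will be the images of [Xp] and [Xm]
    under the map. *)
Lemma sact_delta (f g : nat -> K -> K) (F G : nat -> A) (P M : A)
    (w w' : K -> K) N m u :
    (forall n, function_of_X0 (f n) (F n)) ->
    (forall n, function_of_X0 (g n) (G n)) ->
    (forall h u, act P h u = w u * h (u - eps)) ->
    (forall h u, act M h u = w' u * h (u + eps)) ->
  let b := \sum_(n < N) F n * P ^+ n + \sum_(n < N) G n * M ^+ n.+1 in
  act b (fun v => (v == u - eps *+ m)%:R) u =
    (if (m < N)%N then f m u * \prod_(i < m) w (u - eps *+ i) else 0) /\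
  act b (fun v => (v == u + eps *+ m.+1)%:R) u =
    (if (m < N)%N then g m u * \prod_(i < m.+1) w' (u + eps *+ i) else 0).
Proof.
move=> fF gG PE ME b; rewrite /b !sactD// !sact_sum//.
have pick (t : nat -> K) : \sum_(i < N) t i * (i == m :> nat)%:R =
    if (m < N)%N then t m else 0.
  transitivity (\sum_(i < N | i == m :> nat) t i).
    by rewrite [RHS]big_mkcond; apply: eq_bigr => i _;
      case: eqP => _; rewrite ?mulr0 ?mulr1.
  case: ifP => [mN|/negbT]; first by rewrite (big_pred1 (Ordinal mN)).
  rewrite -leqNgt => Nm; rewrite big1// => i /eqP im; move: (ltn_ord i).
  by rewrite im ltnNge Nm.
split.
(* The powers of [M] step at least once in the opposite direction and miss the delta function. *)
- rewrite [X in _ + X]big1 ?addr0 => [|i _]; last first.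
    by rewrite (sact_term _ _ _ (gG i) ME) mulrn_eps_cross mulr0.
  rewrite -(pick (fun k => f k u * \prod_(j < k) w (u - eps *+ j))).
  apply: eq_bigr => i _; rewrite (sact_term _ _ _ (fF i) PE) mulNrn.
  rewrite mulrn_eps_eqN; congr (_ * _ * _).
  by apply: eq_bigr => j _; rewrite mulNrn.
- rewrite [X in X + _]big1 ?add0r => [|i _]; last first.
    rewrite (sact_term _ _ _ (fF i) PE) mulNrn eq_sym mulrn_eps_cross.
    by rewrite mulr0.
  rewrite -(pick (fun k => g k u * \prod_(j < k.+1) w' (u + eps *+ j))).
  by apply: eq_bigr => i _; rewrite (sact_term _ _ _ (gG i) ME) mulrn_eps_eq.
Qed.

End Coefficients.

(** * The map between the two algebras *)

Section TheMap.
Variable R : realType.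
Local Notation C := R[i].
Variables (rho1 rho2 sp sm : C -> C) (eps1 eps2 lam : C).
Hypothesis eps2_neq0 : eps2 != 0.
Hypothesis sp_neq0 : forall u, sp u != 0.
Hypothesis sm_neq0 : forall u, sm u != 0.
Hypothesis rhoE : forall u, rho1 (eps1 / eps2 * u + lam) = rho2 u * sp u * sm u.

Local Notation A1 := (alg rho1 eps1).
Local Notation A2 := (enlarged_alg rho2 sp sm eps2).
Local Notation xi u := (eps1 / eps2 * u + lam).

(** The slope [eps1 / eps2] is what turns a step [eps2] of the argument into a step [eps1] of its
    image. *)
Let xi_shift u r : xi u + r%:~R * eps1 = xi (u + r%:~R * eps2).
Proof. by field. Qed.

Let spE : function_of_X0 sp (Xsig true 0 : A2).
Proof. exact: (function_of_X0_sig0 _ _ _ true). Qed.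

Let smE : function_of_X0 sm (Xsig false 0 : A2).
Proof. exact: (function_of_X0_sig0 _ _ _ false). Qed.

(** By [shift_alg_hom] only the relations between the proposed images remain. Functions are first
    brought to the same side of [Xp] or [Xm], then compared by their values. *)
Lemma exists_the_map : exists phi : {lrmorphism A1 -> A2}, is_the_map lam phi.
Proof.
pose b0 : A2 := (eps1 / eps2) *: X0 + lam%:A.
pose bp : A2 := Xsig true 0 * Xp.
pose bm : A2 := Xm * Xsig false 0.
pose cls2 := @cls C bool rho2 (fun b : bool => if b then sp else sm) eps2.
(* The target has no symbol for [rho1]; the factorization of [rho1] supplies the image of each
   translate as a product of three symbols with the same index. *)
pose bs (g : option void) (r : int) : A2 :=
  cls2 (emul (eshift None r)
    (emul (eshift (Some true) r) (eshift (Some false) r))).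
have bsE r : function_of_X0 (fun u => rho1 (xi u + r%:~R * eps1)) (bs None r).
  apply: eq_function_of_X0 (function_of_X0_cls _ _ _ _) => // u /=.
  by rewrite xi_shift rhoE mulrA.
have b0E : function_of_X0 (fun u => xi u) b0.
  apply: function_of_X0D (function_of_X0_cst _ _ _ _).
  exact: function_of_X0Z (function_of_X0_X0 _ _ _).
(* The fold of an expression denotes its function composed with the affine map, so expressions with
   equal functions get equal images, as [efold_fun] requires. *)
have efoldE s : no_Xpm s -> function_of_X0
    (fun u => efun rho1 (of_void (C -> C)) eps1 s (xi u)) (efold b0 bp bm bs s).
  elim: s => //= [c _|g r _|s IHs t IHt /andP[ns nt]|s IHs t IHt /andP[ns nt]].
  - exact: function_of_X0_cst.
  - by case: g => // -[].
  - exact: function_of_X0D (IHs ns) (IHt nt).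
  - exact: function_of_X0M (IHs ns) (IHt nt).
have [|||||||phi phiE] := @shift_alg_hom C void rho1 (of_void (C -> C)) eps1 A2
  b0 bp bm bs.
- move=> s t ns nt st; apply: function_of_X0_inj (efoldE s ns) (efoldE t nt).
  by move=> u; exact: st.
- rewrite /bp mulrA (function_of_X0C b0E spE) -!mulrA.
  rewrite (function_of_X0_mul_Xp (b := b0 + eps1%:A) b0E); last first.
    apply: (@eq_function_of_X0 _ _ _ _ _ (fun u => xi u + eps1)) => [u|].
      by field.
    exact: function_of_X0D b0E (function_of_X0_cst _ _ _ _).
  by rewrite mulrDr mulrDr addrAC subrr add0r -!scalerAr mulr1.
- rewrite /bm mulrA (function_of_X0_mul_Xm (b := b0 - eps1%:A) b0E); last first.
    apply: (@eq_function_of_X0 _ _ _ _ _ (fun u => xi u - eps1)) => [u|].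
      by field.
    rewrite -scaleNr; exact: function_of_X0D b0E (function_of_X0_cst _ _ _ _).
  rewrite -!mulrA -(function_of_X0C b0E smE) -mulrBr -mulrBl.
  by rewrite addrAC subrr add0r -scaleNr -scalerAl mul1r -scalerAr.
- move=> [[]|] r; rewrite /bp mulrA (function_of_X0C (bsE _) spE) -!mulrA.
  congr (_ * _); apply: function_of_X0_mul_Xp (bsE _) _.
  apply: eq_function_of_X0 (bsE _) => u; congr (rho1 _).
  by rewrite rmorphD /=; field.
- move=> [[]|] r; rewrite /bm -!mulrA -(function_of_X0C (bsE _) smE) !mulrA.
  congr (_ * _); apply: function_of_X0_mul_Xm (bsE _) _.
  apply: eq_function_of_X0 (bsE _) => u; congr (rho1 _).
  by rewrite rmorphB /=; field.
- rewrite /bp /bm -mulrA (mulrA Xp) Xp_Xm.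
  have rsE := function_of_X0M (function_of_X0_rho _ _ _ 0) smE.
  apply: function_of_X0_inj (function_of_X0M spE rsE) (bsE 0) => u.
  by rewrite !mul0r !addr0 rhoE mulrCA mulrA.
(* Here [sm] and [sp] stand between [Xm] and [Xp]. Moved to the right of [Xp] they are translated by
   [eps2], which matches the argument of [rho2] in [Xm_Xp]. *)
- have ssE := function_of_X0M smE spE.
  have [q qE] := function_of_X0_translate 1 ssE.
  rewrite /bp /bm -mulrA (mulrA (Xsig false 0)).
  rewrite (function_of_X0_mul_Xp (b := q) ssE); last first.
    by apply: eq_function_of_X0 qE => u; rewrite mul1r.
  rewrite mulrA Xm_Xp.
  have rqE := function_of_X0M (function_of_X0_rho _ _ _ 1) qE.
  apply: function_of_X0_inj rqE (bsE 1) => u.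
  by rewrite xi_shift rhoE mulrA mulrAC.
exists phi; split; [exact: phiE eX0|exact: phiE eXp|exact: phiE eXm|].
move=> f a [s [ns sf ->]]; rewrite [phi _]phiE.
by apply: eq_function_of_X0 (efoldE s ns) => u; rewrite sf.
Qed.

Variable phi : {lrmorphism A1 -> A2}.
Hypothesis phi_map : is_the_map lam phi.

(* Both weightings are needed: with the weight rho2 on X_+ (resp. X_-) the
   zeros of rho2 hide the coefficients of the powers of X_+ (resp. X_-). *)
Local Notation rho2' := (fun u => rho2 (u + eps2)).

Let weight_p (u : C) : 1 * rho2' (u - eps2) = rho2 u.
Proof. by rewrite /= subrK mul1r. Qed.

Let weight_m (u : C) : rho2 u * 1 = rho2 u.
Proof. exact: mulr1. Qed.

(** The images of [Xp] and [Xm] act with weights [sp u * wp u] and [wm u * sm (u + eps2)]; the extra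
    [eps2] arises because [Xm] stands to the left of [sm]. Setting [wp] or [wm] to 1 leaves only
    nonvanishing factors. *)
Lemma the_map_normal_form N a : normal_form N a ->
  exists (f g : nat -> C -> C) (F G : nat -> A1),
    [/\ forall n, function_of_X0 (f n) (F n),
        forall n, function_of_X0 (g n) (G n),
        a = \sum_(n < N) F n * Xp ^+ n + \sum_(n < N) G n * Xm ^+ n.+1,
        forall m u, (m < N)%N ->
          sact (fun=> 1) rho2' (phi a) (fun v => (v == u - eps2 *+ m)%:R) u =
          f m (xi u) * \prod_(i < m) sp (u - eps2 *+ i)
      & forall m u, (m < N)%N ->
          sact rho2 (fun=> 1) (phi a) (fun v => (v == u + eps2 *+ m.+1)%:R) u =
          g m (xi u) * \prod_(i < m.+1) sm (u + eps2 *+ i + eps2)].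
Proof.
move=> [f [g [F [G [fF gG aE]]]]]; exists f, g, F, G.
have [_ phip phim phif] := phi_map.
have phiF n := phif _ _ (fF n); have phiG n := phif _ _ (gG n).
have phiaE : phi a = \sum_(n < N) phi (F n) * phi Xp ^+ n +
    \sum_(n < N) phi (G n) * phi Xm ^+ n.+1.
  rewrite aE rmorphD !rmorph_sum; congr (_ + _); apply: eq_bigr => i _;
  by rewrite rmorphM rmorphXn.
have phipE wp wm (H : forall u, wp u * wm (u - eps2) = rho2 u) h u :
    sact wp wm (phi Xp) h u = sp u * wp u * h (u - eps2).
  by rewrite phip sactM// (sact_fun H _ _ spE) sactXp// mulrA.
have phimE wp wm (H : forall u, wp u * wm (u - eps2) = rho2 u) h u :
    sact wp wm (phi Xm) h u = wm u * sm (u + eps2) * h (u + eps2).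
  by rewrite phim sactM// sactXm// (sact_fun H _ _ smE) mulrA.
split=> // m u mN.
- have := sact_delta weight_p eps2_neq0 N m u phiF phiG
    (phipE (fun=> 1) rho2' weight_p) (phimE (fun=> 1) rho2' weight_p).
  rewrite -phiaE mN => -[-> _]; congr (_ * _).
  by apply: eq_bigr => i _; rewrite mulr1.
- have := sact_delta weight_m eps2_neq0 N m u phiF phiG
    (phipE rho2 (fun=> 1) weight_m) (phimE rho2 (fun=> 1) weight_m).
  rewrite -phiaE mN => -[_ ->]; congr (_ * _).
  by apply: eq_bigr => i _; rewrite mul1r.
Qed.

(** If the image is zero, each coefficient vanishes at all values of the affine map, which is onto
    because [eps1] is nonzero. The coefficients are then zero as elements. *)
Lemma the_map_inj : eps1 != 0 -> injective phi.
Proof.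
move=> eps1_neq0; apply: raddf_inj => a phia.
have [N aN] := exists_normal_form a.
have [f [g [F [G [fF gG aE fE gE]]]]] := the_map_normal_form aN.
have xi_surj u : xi ((u - lam) * eps2 / eps1) = u.
  by field; rewrite eps1_neq0.
have F0 n : (n < N)%N -> F n = 0.
  move=> nN; apply: function_of_X0_inj (fF n) (function_of_X0_0 _ _ _) => u.
  have := fE n ((u - lam) * eps2 / eps1) nN.
  rewrite phia sact0// xi_surj => /esym/eqP; rewrite mulf_eq0 => /orP[/eqP//|].
  by move/prodf_eq0 => [i _]; rewrite (negPf (sp_neq0 _)).
have G0 n : (n < N)%N -> G n = 0.
  move=> nN; apply: function_of_X0_inj (gG n) (function_of_X0_0 _ _ _) => u.
  have := gE n ((u - lam) * eps2 / eps1) nN.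
  rewrite phia sact0// xi_surj => /esym/eqP; rewrite mulf_eq0 => /orP[/eqP//|].
  by move/prodf_eq0 => [i _]; rewrite (negPf (sm_neq0 _)).
by rewrite aE !big1 ?addr0// => i _; rewrite ?F0 ?G0// mul0r.
Qed.

(** The degree 0 coefficient of a preimage already accounts for [f]. This restricts which functions
    lie in the image. *)
Lemma the_map_function f a : function_of_X0 f (phi a) ->
  exists2 s : expr C void, no_Xpm s &
    forall u, f u = efun rho1 (of_void (C -> C)) eps1 s (xi u).
Proof.
move=> fa; have [N aN] := exists_normal_form a.
(* The bound [N.+1] always admits the index 0, where the product of values of [sp] is empty. *)
have [h [_ [F [_ [hF _ _ fE _]]]]] :=
  the_map_normal_form (normal_form_widen (leqnSn N) aN).
have [s [ns sh _]] := hF 0%N; exists s => // u.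
rewrite sh; have := fE 0%N u isT; rewrite mulr0n subr0 big_ord0 mulr1 => <-.
by rewrite (sact_fun weight_p _ _ fa) eqxx mulr1.
Qed.

End TheMap.

(** * Analytic functions and the identity theorem *)

Section PowerSeries.
Variable K : numFieldType.
Implicit Types (f : K -> K) (a : nat -> K) (z w : K).

Lemma norm_limit_le (s : nat -> K) (l c B : K) m :
  s n @[n --> \oo] --> l -> (forall n, (m <= n)%N -> `|s n - c| <= B) ->
  `|l - c| <= B.
Proof.
move=> sl sB; apply/ler_addgt0Pr => e e0.
move/cvgrPdist_le : sl => /(_ _ e0)[N _ Nl].
rewrite -(subrK (s (maxn m N)) l) -addrA addrC.
rewrite (le_trans (ler_normD _ _))// lerD//; first by rewrite sB// leq_maxl.
by rewrite Nl//= leq_maxr.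
Qed.

Lemma cvg_seq_bound (u : nat -> K) : u n @[n --> \oo] --> 0 ->
  exists2 M, 0 <= M & forall n, `|u n| <= M.
Proof.
move=> /cvgrPdist_le/(_ 1 ltr01)[N _ Nu].
exists (1 + \sum_(i < N) `|u i|) => [|n].
  by rewrite addr_ge0// sumr_ge0.
have [nN|Nn] := ltnP n N.
  rewrite (bigD1 (Ordinal nN))//= addrCA lerDl addr_ge0// sumr_ge0//.
rewrite -[leLHS]addr0 lerD ?sumr_ge0//.
by have := Nu n Nn; rewrite /= sub0r normrN.
Qed.

(** Boundedness of the terms at radius [rho *+ 2] gains a factor 1/2 per term at radius [rho]. The
    last factor is the geometric sum of [k] terms, kept exact so that the induction closes. *)
Lemma power_series_partial_sum_le a (M rho w : K) m k : 0 < rho -> 0 <= M ->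
    (forall n, `|a n * (rho *+ 2) ^+ n| <= M) -> `|w| <= rho ->
  `|\sum_(n < m + k) a n * w ^+ n - \sum_(n < m) a n * w ^+ n| <=
    M * (`|w| / rho) ^+ m * (2 - 2 / 2 ^+ k).
Proof.
move=> r0 M0 aM wr.
elim: k => [|k IHk].
  by rewrite addn0 subrr normr0 expr0 divr1 subrr mulr0.
rewrite addnS big_ord_recr /= addrAC.
have -> : 2 - 2 / 2 ^+ k.+1 = 2 - 2 / 2 ^+ k + 1 / 2 ^+ k :> K.
  by rewrite exprS; field; rewrite expf_neq0// pnatr_eq0.
rewrite mulrDr (le_trans (ler_normD _ _))// lerD//.
set q := `|w| / rho.
have q1 : q <= 1 by rewrite ler_pdivrMr// mul1r.
have q0 : 0 <= q by rewrite divr_ge0// ltW.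
have wE : `|w| = q / 2 * (rho *+ 2).
  by rewrite -mulr_natr /q; field; rewrite gt_eqF.
have := aM (m + k)%N; rewrite !normrM !normrX.
rewrite (ger0_norm (x := rho *+ 2)) ?mulrn_wge0 ?(ltW r0)// => ak.
rewrite wE exprMn mulrCA (le_trans (ler_wpM2l _ ak))//.
  by rewrite exprn_ge0// divr_ge0.
have -> : (q / 2) ^+ (m + k) = q ^+ m * (1 / 2 ^+ k) * (q ^+ k * 2^-1 ^+ m).
  by rewrite exprMn !exprD exprVn [2^-1 ^+ k]exprVn; ring.
rewrite mulrC !mulrA -[leLHS]mulrA ler_piMr//.
  by rewrite !mulr_ge0// ?exprn_ge0// divr_ge0 ?exprn_ge0.
rewrite mulr_ile1 ?exprn_ge0 ?exprn_ile1//.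
by rewrite invf_le1// ler1n.
Qed.

(** The constants [M] and [r] serve for every order [m]: order 1 gives continuity, and all orders
    together give the isolation of zeros. *)
Lemma analytic_taylor f z0 : analytic_fun f -> exists a (M r : K),
  [/\ 0 < r, 0 <= M,
      forall w, `|w| < r ->
        (\sum_(i < n) a i * w ^+ i) @[n --> \oo] --> f (z0 + w)
    & forall m w, `|w| < r ->
        `|f (z0 + w) - \sum_(n < m) a n * w ^+ n| <= M * (`|w| / r) ^+ m].
Proof.
move=> /(_ z0)[a /nbhs_ballP[e /= e0 ze]].
have ser w : `|w| < e ->
    (\sum_(i < n) a i * w ^+ i) @[n --> \oo] --> f (z0 + w).
  move=> we; have := ze (z0 + w); rewrite -ball_normE /= opprD addrA subrr.
  rewrite sub0r normrN addrAC subrr add0r => /(_ we).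
  apply: cvg_trans; apply: near_eq_cvg; near=> n.
  by rewrite /series/= big_mkord.
(* A quarter of the radius keeps [r *+ 2] inside the disc of convergence, where the terms tend to 0
   and are therefore bounded. *)
pose r := e / 4.
have r0 : 0 < r by rewrite divr_gt0.
have r2 : 0 < r *+ 2 by rewrite mulrn_wgt0.
have [M M0 aM] : exists2 M, 0 <= M & forall n, `|a n * (r *+ 2) ^+ n| <= M.
  apply: cvg_seq_bound; apply: (@cvg_series_cvg_0 _ K^o).
  have r2e : `|r *+ 2| < e.
    rewrite gtr0_norm// /r -mulr_natr -mulrA gtr_pMr//.
    by rewrite ltr_pdivrMl// mulr1 ltr_nat.
  apply/cvg_ex; exists (f (z0 + r *+ 2)).
  apply: cvg_trans (ser _ r2e); apply: near_eq_cvg; near=> n.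
  by rewrite /series/= big_mkord.
exists a, (M * 2), r; split=> // [|w wr|m w wr].
- by rewrite mulr_ge0.
- apply: ser; rewrite (lt_trans wr)// /r gtr_pMr//.
  by rewrite invf_lt1// ltr1n.
- apply: (@norm_limit_le _ _ _ _ m (ser w _)).
    by rewrite (lt_trans wr)// /r gtr_pMr// invf_lt1// ltr1n.
  move=> n mn; rewrite -(subnKC mn).
  rewrite (le_trans (power_series_partial_sum_le _ _ _ M0 aM (ltW wr)))//.
  rewrite (mulrAC M 2) ler_wpM2l ?mulr_ge0 ?exprn_ge0 ?divr_ge0 ?(ltW e0)//.
  by rewrite gerBl divr_ge0 ?exprn_ge0.
Unshelve. all: by end_near. Qed.

Lemma pos_lower_bound (x y : K) : 0 < x -> 0 < y ->
  exists e, [/\ 0 < e, e <= x & e <= y].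
Proof.
move=> x0 y0; have xy0 : 0 < x + y by exact: addr_gt0.
(* Half the harmonic mean lies below both numbers, with no case distinction on which is smaller. *)
exists (x * y / (x + y)); split; first by rewrite divr_gt0// mulr_gt0.
  by rewrite ler_pdivrMr// ler_pM2l// lerDr ltW.
by rewrite ler_pdivrMr// mulrC ler_pM2l// lerDl ltW.
Qed.

Lemma near_norm z0 r : 0 < r -> \forall z \near z0, `|z - z0| < r.
Proof.
move=> r0; apply/nbhs_ballP; exists r => // z.
by rewrite -ball_normE /= distrC.
Qed.

Lemma analytic_continuous f : analytic_fun f -> continuous f.
Proof.
move=> fan z0; have [a [M [r [r0 M0 fa fle]]]] := analytic_taylor z0 fan.
have fz0 : f z0 = a 0%N.
  apply/eqP; rewrite -subr_eq0 -normr_le0.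
  have := fle 1%N 0; rewrite normr0 addr0 mul0r expr1 mulr0 big_ord1 expr0.
  by rewrite mulr1; apply.
(* [M] may be 0; [M + 1] can be divided by. *)
have M1 : 0 < M + 1 by rewrite (lt_le_trans ltr01)// lerDr.
suff H (e : K) : 0 < e -> \forall z \near z0, `|f z0 - f z| <= e.
  by apply/(@cvgrPdist_le _ _ _ (nbhs z0)).
move=> e0; near=> z.
have zr : `|z - z0| < r by near: z; exact: near_norm.
have := fle 1%N (z - z0) zr; rewrite big_ord1 expr0 mulr1 -fz0 (addrC z0).
rewrite subrK distrC expr1 => /le_trans; apply.
apply: (@le_trans _ _ ((M + 1) * (`|z - z0| / r))).
  by rewrite ler_wpM2r ?divr_ge0 ?(ltW r0)// lerDl.
rewrite -ler_pdivlMl// ler_pdivrMr// ltW//.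
by near: z; apply: near_norm; rewrite mulr_gt0// mulr_gt0// invr_gt0.
Unshelve. all: by end_near. Qed.

(* If a_k = 0 for all k < n, then f (z0 + w) = 0 with w != 0 forces
   |a_n| = O(|w|). *)
Lemma analytic_isolated_zero f z0 : analytic_fun f ->
    (forall e, 0 < e -> exists w, [/\ w != 0, `|w| < e & f (z0 + w) = 0]) ->
  \forall z \near z0, f z = 0.
Proof.
move=> fan fw; have [a [M [r [r0 M0 fa fle]]]] := analytic_taylor z0 fan.
have M1 : 0 < M + 1 by rewrite (lt_le_trans ltr01)// lerDr.
have a0 n : a n = 0.
  elim/ltn_ind: n => n IHn; apply/eqP; rewrite -normr_le0.
  apply/ler_addgt0Pr => e e0; rewrite add0r.
  (* This bound on [|w|] is chosen so that the remainder estimate of order [n.+1], after cancelling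
     [|w| ^+ n], yields [|a n| <= e]. *)
  have d0 : 0 < e * r ^+ n.+1 / (M + 1).
    by rewrite divr_gt0 ?mulr_gt0 ?exprn_gt0.
  have [d [d_gt0 dr de]] := pos_lower_bound r0 d0.
  have [w [w0 wd fw0]] := fw _ d_gt0.
  have := fle n.+1 w (lt_le_trans wd dr).
  rewrite fw0 sub0r normrN big_ord_recr /= big1 => [|i _]; last first.
    by rewrite IHn ?mul0r.
  rewrite add0r normrM normrX expr_div_n exprSr mulrA.
  rewrite ler_pdivlMr ?exprn_gt0// -!mulrA (mulrCA _ (`|w| ^+ n)) (mulrCA M).
  rewrite ler_pM2l ?exprn_gt0 ?normr_gt0// => aM.
  rewrite -(@ler_pM2r _ (r ^+ n.+1)) ?exprn_gt0// (le_trans aM)//.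
  rewrite (@le_trans _ _ ((M + 1) * `|w|))//.
    by rewrite ler_wpM2r// lerDl.
  by rewrite -ler_pdivlMl// mulrC ltW// (lt_le_trans wd).
near=> z.
have zr : `|z - z0| < r by near: z; exact: near_norm.
have := fa (z - z0) zr; rewrite (addrC z0) subrK => fz.
apply: (cvg_unique (@norm_hausdorff K K) fz).
rewrite [X in X @ _](_ : _ = fun=> 0); first exact: cvg_cst.
by apply/funext => n; rewrite big1// => i _; rewrite a0 mul0r.
Unshelve. all: by end_near. Qed.

Lemma analytic_funB f g :
  analytic_fun f -> analytic_fun g -> analytic_fun (fun z => f z - g z).
Proof.
move=> fan gan z0; have [a fa] := fan z0; have [b gb] := gan z0.
exists (fun n => a n - b n); near=> z.
have fz : series (fun n => a n * (z - z0) ^+ n) @ \oo --> f z by near: z.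
have gz : series (fun n => b n * (z - z0) ^+ n) @ \oo --> g z by near: z.
rewrite [X in X @ _](_ : _ = series (fun n => a n * (z - z0) ^+ n) \-
    series (fun n => b n * (z - z0) ^+ n)); first exact: cvgB fz gz.
apply/funext => n; rewrite /series/= -sumrB.
by apply: eq_bigr => i _; rewrite mulrBl.
Unshelve. all: by end_near. Qed.

End PowerSeries.

(** * Identity theorem and reflection in the complex plane *)

Section ComplexAnalytic.
Variable R : realType.
Local Notation K := (R[i] : numFieldType).
Implicit Types f g : R[i] -> R[i].

Lemma norm_real_complex (x : R) : `|x%:C| = `|x|%:C.
Proof. by rewrite normc_def /= expr0n /= addr0 sqrtr_sqr. Qed.

Lemma norm_imaginary (x : R) : `|x *i| = `|x|%:C.
Proof. by rewrite normc_def /= expr0n /= add0r sqrtr_sqr. Qed.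

Lemma pos_complexP (e : R[i]) : 0 < e -> exists2 d : R, 0 < d & e = d%:C.
Proof.
case: e => a b; rewrite ltcE /= => /andP[/eqP -> a0]; by exists a.
Qed.

Lemma near_complexP (P : R[i] -> Prop) (z0 : R[i]) :
  (\forall z \near (z0 : K), P z) <->
  exists2 d : R, 0 < d & forall z, `|z - z0| < d%:C -> P z.
Proof.
split=> [/nbhs_ballP[e /= /pos_complexP[d d0 ->]] dP|[d d0 dP]].
  exists d => // z zd; apply: dP; by rewrite -ball_normE /= distrC.
apply/nbhs_ballP; exists d%:C => /=; first by rewrite (ltcR 0).
by move=> z; rewrite -ball_normE /= distrC => /dP.
Qed.

(** On the vertical line through [x], the heights near which [f] vanishes identically form an open
    and closed set containing 0. Only the connectedness of the real line is needed. *)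
Lemma analytic_zero f : analytic_fun f -> (forall x : R, f x%:C = 0) ->
  forall z, f z = 0.
Proof.
move=> fan f0 [x y].
pose A := [set t : R | \forall z \near (x +i* t : K), f z = 0].
have subE t s : (x +i* s) - (x +i* t) = (s - t) *i :> R[i].
  by apply/eqP; rewrite eq_complex /= subrr !eqxx.
have openA : open A.
  rewrite openE => t /near_complexP[d d0 dP].
  apply/nbhs_ballP; exists (d / 2); first by rewrite /= divr_gt0.
  move=> s; rewrite -ball_normE /= => st.
  apply/near_complexP; exists (d / 2); first by rewrite divr_gt0.
  move=> z zs; apply: dP.
  rewrite -(subrKA (x +i* s)) (le_lt_trans (ler_normD _ _))//.
  rewrite (splitr d) rmorphD ltrD// subE norm_imaginary ltcR distrC //.
(* If [f] is not zero near height [t], its zeros on the line do not accumulate there, so no nearby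
   height belongs to [A]. *)
have closedA : closed A.
  rewrite -openC openE => t /= nAt.
  have [d d0 dP] : exists2 d : R, 0 < d & forall s, s != t -> `|s - t| < d ->
      f (x +i* s) != 0.
    apply: contrapT => H; apply: nAt.
    apply: (@analytic_isolated_zero K) => // e /pos_complexP[d d0 ->].
    apply: contrapT => nw; apply: H; exists d => // s st sd.
    apply/eqP => fs; apply: nw; exists ((s - t) *i); split.
    - by rewrite eq_complex /= eqxx subr_eq0.
    - by rewrite norm_imaginary ltcR.
    - by rewrite -subE addrC subrK.
  apply/nbhs_ballP; exists d; first exact: d0.
  move=> s; rewrite -ball_normE /= distrC => sd As.
  have [st|st] := eqVneq s t; first by apply: nAt; rewrite -st.
  by have /eqP := dP s st sd; apply; apply: nbhs_singleton As.
have A0 : A 0.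
  apply: (@analytic_isolated_zero K) => // e /pos_complexP[d d0 ->].
  exists (d / 2)%:C; split.
  - by rewrite eq_complex /= eqxx andbT gt_eqF// divr_gt0.
  - rewrite norm_real_complex ltcR gtr0_norm ?divr_gt0//.
    by rewrite ltr_pdivrMr// ltr_pMr// ltr1n.
  - rewrite -[RHS](f0 (x + d / 2)); congr f.
    by apply/eqP; rewrite eq_complex /= addr0 !eqxx.
suff AT : A = setT.
  have : A y by rewrite AT.
  by move=> /nbhs_singleton.
have /connected_intervalP cT : is_interval [set: R] by [].
apply: cT; first by exists 0.
  by exists A => //; rewrite setTI.
by exists A => //; rewrite setTI.
Qed.

Lemma eq_analytic f g : analytic_fun f -> analytic_fun g ->
  (forall x : R, f x%:C = g x%:C) -> f =1 g.
Proof.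
move=> fan gan fg z; apply/eqP; rewrite -subr_eq0; apply/eqP.
apply: (analytic_zero (@analytic_funB K _ _ fan gan)) => x.
by rewrite fg subrr.
Qed.

(** The coefficients are the conjugates of those at the conjugate centre; conjugation preserves the
    norm and hence convergence. *)
Lemma analytic_conj f : analytic_fun f -> analytic_fun (fun z => (f z^*)^*).
Proof.
move=> fan z0; have [a /near_complexP[d d0 dP]] := fan (z0^*).
exists (fun n => (a n)^*); apply/near_complexP; exists d => // z zd.
have {}dP : series (fun n => a n * (z^* - z0^*) ^+ n) @ \oo --> (f z^* : K).
  by apply: dP; rewrite -rmorphB normcJ.
apply/cvgrPdist_lt => e e0.
move/cvgrPdist_lt : dP => /(_ e e0); apply: filterS => n.
suff -> : series (fun k => (a k)^* * (z - z0) ^+ k) n =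
    (series (fun k => a k * (z^* - z0^*) ^+ k) n)^*.
  have := normcJ (f z^* - series (fun k => a k * (z^* - z0^*) ^+ k) n).
  by rewrite rmorphB => /= ->.
rewrite /series/= rmorph_sum; apply: eq_bigr => i _.
by rewrite rmorphM rmorphXn rmorphB /= !conjcK.
Qed.

(** Schwarz reflection: both sides are analytic and agree on the real line. *)
Lemma real_analytic_conj f : analytic_fun f -> real_function f ->
  forall z, (f z^*)^* = f z.
Proof.
move=> fan fr; apply: (eq_analytic (analytic_conj fan) fan) => x.
rewrite conjc_real; have /complex_realP[y ->] := fr x.
by rewrite conjc_real.
Qed.

End ComplexAnalytic.

(** * The complex exponential *)

Section ExponentialSums.

Lemma sum_triangle (V : nmodType) (F : nat -> nat -> V) N :
  \sum_(n < N) \sum_(i < n.+1) F (n - i)%N i =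
  \sum_(i < N) \sum_(j < N - i) F j i.
Proof.
elim: N => [|N IHN]; first by rewrite !big_ord0.
rewrite !big_ord_recr /= IHN subSnn big_ord1 subnn addrA; congr (_ + _).
rewrite -big_split; apply: eq_bigr => i _ /=.
by rewrite subSn 1?ltnW// big_ord_recr.
Qed.

Definition exp_sum (K : numFieldType) N (z : K) := \sum_(i < N) z ^+ i / i`!%:R.

(** By the binomial theorem the partial sum at [a + b] is the triangle [i + j < N] inside the square
    of the product; the rest of the square remains. *)
Lemma exp_sum_mulB (K : numFieldType) N (a b : K) :
  exp_sum N a * exp_sum N b - exp_sum N (a + b) =
  \sum_(i < N) \sum_(N - i <= j < N) (a ^+ j / j`!%:R) * (b ^+ i / i`!%:R).
Proof.
have -> : exp_sum N (a + b) =
    \sum_(i < N) \sum_(j < N - i) (a ^+ j / j`!%:R) * (b ^+ i / i`!%:R).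
  rewrite -(sum_triangle (fun j i => (a ^+ j / j`!%:R) * (b ^+ i / i`!%:R))).
  apply: eq_bigr => n _.
  rewrite exprDn mulr_suml; apply: eq_bigr => i _.
  have in_ : (i <= n)%N by rewrite -ltnS.
  have := bin_fact in_ => /(congr1 (fun k => k%:R : K)) nE.
  rewrite -mulr_natr -nE !natrM; field.
  by rewrite !pnatr_eq0 -!lt0n !fact_gt0 bin_gt0 in_.
rewrite /exp_sum mulrC mulr_suml -sumrB; apply: eq_bigr => i _.
rewrite mulr_sumr.
rewrite -!(big_mkord xpredT (fun j => a ^+ j / j`!%:R * (b ^+ i / i`!%:R))).
rewrite -(big_mkord xpredT (fun j => b ^+ i / i`!%:R * (a ^+ j / j`!%:R))).
under eq_bigr do rewrite mulrC.
rewrite (@big_cat_nat _ _ _ (N - i)%N) ?leq_subr//=.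
by rewrite addrAC subrr add0r.
Qed.

(** The terms left over in [exp_sum_mulB] have positive coefficients, so the complex defect is
    dominated by the same defect at the norms, where the real exponential is available. *)
Lemma exp_sum_mulB_norm (K : numFieldType) N (a b : K) :
  `|exp_sum N a * exp_sum N b - exp_sum N (a + b)| <=
  exp_sum N `|a| * exp_sum N `|b| - exp_sum N (`|a| + `|b|).
Proof.
rewrite !exp_sum_mulB (le_trans (ler_norm_sum _ _ _))// ler_sum// => i _.
rewrite (le_trans (ler_norm_sum _ _ _))// ler_sum// => j _.
by rewrite !normrM !normrX !normfV !normr_nat.
Qed.

End ExponentialSums.

Section ComplexExponential.
Variable R : realType.
Local Notation K := (R[i] : numFieldType).

(** Euler's formula gives the functional equation and the period directly from the real functions;
    [cvg_cexp] recovers the power series. *)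
Definition cexp (z : R[i]) : R[i] :=
  (expR (complex.Re z))%:C * (cos (complex.Im z) +i* sin (complex.Im z)).

Lemma cexpD z w : cexp (z + w) = cexp z * cexp w.
Proof.
case: z w => [x y] [x' y']; rewrite /cexp /= expRD cosD sinD rmorphM /=.
by apply/eqP; rewrite eq_complex /=; apply/andP; split; apply/eqP; ring.
Qed.

Lemma cexp0 : cexp 0 = 1.
Proof. by rewrite /cexp /= expR0 cos0 sin0 mul1r. Qed.

Lemma cexp_neq0 z : cexp z != 0.
Proof.
apply/eqP => z0; have := cexp0; rewrite -(subrr z) cexpD z0 mul0r => /eqP.
by rewrite eq_sym oner_eq0.
Qed.

Lemma cexp_real (x : R) : cexp x%:C = (expR x)%:C.
Proof. by rewrite /cexp /= cos0 sin0 mulr1. Qed.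

Lemma cexp_period n : cexp ((pi *+ 2 *+ n) *i) = 1.
Proof.
rewrite /cexp /= expR0 mul1r.
elim: n => [|n IHn]; first by rewrite mulr0n cos0 sin0.
by rewrite mulrS addrC cosD2pi sinD2pi.
Qed.

Lemma exp_sum_real N (x : R) : exp_sum N (x%:C : K) = (exp_sum N x)%:C.
Proof.
rewrite /exp_sum rmorph_sum; apply: eq_bigr => i _.
by rewrite rmorphM fmorphV rmorphXn rmorph_nat.
Qed.

Lemma exp_sum_series (x : R) : (fun n => exp_sum n x) = series (exp_coeff x).
Proof. by apply/funext => n; rewrite /series/= big_mkord. Qed.

Lemma mul_complex_real (a b c : R) : (a +i* b) * c%:C = (a * c) +i* (b * c).
Proof.
by apply/eqP; rewrite eq_complex /= !mulr0 subr0 add0r !eqxx.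
Qed.

Lemma imaginary_pow_double (y : R) m :
  (y *i) ^+ m.*2 = ((-1) ^+ m * y ^+ m.*2)%:C :> R[i].
Proof.
have -> : (y *i) ^+ m.*2 = ((- y ^+ 2)%:C) ^+ m :> R[i].
  rewrite -mul2n exprM; congr (_ ^+ m).
  by apply/eqP; rewrite eq_complex /= !mul0r !mulr0 sub0r addr0 !eqxx.
rewrite -rmorphXn; congr (_%:C).
by rewrite [LHS]exprNn -mul2n exprM.
Qed.

Lemma imaginary_exp_term (y : R) n :
  (y *i) ^+ n / n`!%:R = cos_coeff y n +i* sin_coeff y n :> R[i].
Proof.
rewrite -(rmorph_nat (real_complex R)) -fmorphV /cos_coeff /sin_coeff /=.
rewrite -mul_complex_real; congr (_ * _).
rewrite -(odd_double_half n); case: (odd n) => /=.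
  rewrite !add1n /= !odd_double /= ?doubleK exprS imaginary_pow_double.
  rewrite mul_complex_real mul0r mul1r.
  congr (_ +i* _); first by rewrite !mul0r.
  by rewrite exprS mulrCA.
rewrite !add0n odd_double /= doubleK imaginary_pow_double.
by rewrite mul1r !mul0r.
Qed.

Lemma exp_sum_imaginary N (y : R) : exp_sum N (y *i : K) =
  series (cos_coeff y) N +i* series (sin_coeff y) N.
Proof.
elim: N => [|N IHN].
  by rewrite /exp_sum big_ord0 /series /= !big_geq.
rewrite /exp_sum big_ord_recr /= -/(exp_sum N _) IHN.
rewrite /series /= !big_nat_recr//=.
by rewrite [X in _ + X]imaginary_exp_term.
Qed.

Lemma cvg_complex (u v : nat -> R) (a b : R) :
  u n @[n --> \oo] --> a -> v n @[n --> \oo] --> b ->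
  (u n +i* v n) @[n --> \oo] --> (a +i* b : K).
Proof.
move=> /cvgrPdist_lt ua /cvgrPdist_lt vb.
apply/(@cvgrPdist_lt K K) => e /pos_complexP[d d0 ->].
have d2 : 0 < d / 2 by rewrite divr_gt0.
near=> n.
have -> : (a +i* b) - (u n +i* v n) = (a - u n)%:C + (b - v n) *i :> R[i].
  by apply/eqP; rewrite eq_complex /= addr0 add0r !eqxx.
rewrite (le_lt_trans (ler_normD _ _))// norm_real_complex norm_imaginary.
rewrite -rmorphD ltcR (splitr d) ltrD//.
  by near: n; exact: ua.
by near: n; exact: vb.
Unshelve. all: by end_near. Qed.

(** The product of the partial sums at the real and the imaginary part converges to [cexp z]. Its
    distance to the partial sum at [z] is at most [d n], which tends to 0 by the real addition
    formula. *)
Lemma cvg_cexp z : exp_sum n z @[n --> \oo] --> (cexp z : K).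
Proof.
case: z => x y.
pose E : nat -> K := fun n => exp_sum n (x%:C : K) * exp_sum n (y *i : K).
have expRcvg (t : R) : exp_sum n t @[n --> \oo] --> expR t.
  by rewrite exp_sum_series; exact: is_cvg_series_exp_coeff.
have Ecvg : E n @[n --> \oo] --> (cexp (x +i* y) : K).
  rewrite /cexp /=; apply: (@cvgM K).
    under eq_fun do rewrite exp_sum_real.
    exact: cvg_complex (expRcvg x) (cvg_cst 0).
  under eq_fun do rewrite exp_sum_imaginary.
  apply: cvg_complex; rewrite unlock.
    exact: is_cvg_series_cos_coeff.
  exact: is_cvg_series_sin_coeff.
pose d n := exp_sum n `|x| * exp_sum n `|y| - exp_sum n (`|x| + `|y|).
have dcvg : d n @[n --> \oo] --> 0.
  rewrite -(subrr (expR (`|x| + `|y|))) {1}expRD.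
  by apply: cvgB => //; apply: cvgM.
have Ed n : `|E n - exp_sum n (x +i* y : K)| <= (d n)%:C.
  have -> : x +i* y = x%:C + y *i :> R[i].
    by apply/eqP; rewrite eq_complex /= addr0 add0r !eqxx.
  rewrite (le_trans (exp_sum_mulB_norm _ _ _))//.
  rewrite norm_real_complex norm_imaginary -rmorphD !exp_sum_real.
  by rewrite -rmorphM -rmorphB.
have Dcvg : (E n - exp_sum n (x +i* y : K)) @[n --> \oo] --> (0 : K).
  apply/(@cvgrPdist_lt K K) => e /pos_complexP[c c0 ->].
  move/cvgrPdist_lt : dcvg => /(_ c c0); apply: filterS => n.
  rewrite !sub0r !normrN => dc; rewrite (le_lt_trans (Ed n))// ltcR.
  exact: le_lt_trans (ler_norm _) dc.
rewrite [X in X @ _](_ : _ = E \- (fun n => E n - exp_sum n (x +i* y : K))).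
  rewrite -(subr0 (cexp _)).
  exact: (@cvgB K K _ _ _ _ _ _ _ Ecvg Dcvg).
by apply/funext => n; rewrite /= subKr.
Qed.

(** The functional equation transports the expansion at 0 to [z0]. *)
Lemma analytic_cexp : analytic_fun cexp.
Proof.
move=> z0; exists (fun n => cexp z0 / n`!%:R); near=> z.
have -> : cexp z = cexp z0 * cexp (z - z0) by rewrite -cexpD addrC subrK.
rewrite [X in X @ _](_ : _ = fun n => cexp z0 * exp_sum n (z - z0 : K)).
  have cz0 : (fun _ : nat => cexp z0 : K) n @[n --> \oo] --> (cexp z0 : K).
    exact: cvg_cst.
  exact: (cvgM cz0 (@cvg_cexp (z - z0))).
apply/funext => n; rewrite /series/= big_mkord mulr_sumr.
by apply: eq_bigr => i _; rewrite mulrAC mulrA.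
Unshelve. all: by end_near. Qed.

(** The multiples of the period would give [p - 1] as many distinct roots as its size, one more than
    its degree permits. So [p] would be 1, contradicting [cexp 1 != 1]. *)
Lemma cexp_not_polynomial (p : {poly R[i]}) : ~ (forall z, cexp z = p.[z]).
Proof.
move=> pE; have p1 : p - 1 = 0.
  apply/eqP/contraT => p1.
  pose s := [seq (pi *+ 2 *+ n) *i : R[i] | n <- iota 0 (size (p - 1))].
  have := @max_poly_roots _ (p - 1) s p1.
  rewrite size_map size_iota ltnn => -> //.
    apply/allP => _ /mapP[n _ ->]; rewrite rootE !hornerE -pE cexp_period.
    by rewrite subrr.
  rewrite map_inj_uniq ?iota_uniq// => m n [] /eqP.
  rewrite -!(mulr_natr (pi *+ 2)) (inj_eq (mulfI _)) ?eqr_nat.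
    by move/eqP.
  by rewrite mulrn_eq0 /= gt_eqF// pi_gt0.
have := pE 1%:C; rewrite -(subrK 1 p) p1 add0r hornerE cexp_real => -[] /eqP.
by rewrite gt_eqF// expR_gt1.
Qed.

End ComplexExponential.

(** * Conjugation *)

Local Arguments conjc : simpl never.

Lemma conjcN (R : realType) (z : R[i]) : conjc (- z) = - conjc z.
Proof. exact: rmorphN. Qed.

Lemma conjcN1 (R : realType) : conjc (-1) = -1 :> R[i].
Proof. by rewrite conjcN conjc1. Qed.

Section Conjugation.
Variables (R : realType) (J : Type) (rho : R[i] -> R[i]).
Variables (sigma : J -> R[i] -> R[i]) (eps : R[i]) (tau : J -> J).
Hypothesis eps_conj : eps^* = eps.
Hypothesis rho_conj : forall z, rho z = (rho z^*)^*.
Hypothesis sigma_conj : forall j z, sigma (tau j) z = (sigma j z^*)^*.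

Local Notation A := (shift_alg rho sigma eps).
Local Notation cls := (@cls R[i] J rho sigma eps).

(** [tau] gives the index of the reflected function; in the target algebra it swaps [sp] and [sm].
    Indices of translates stay fixed because [eps] is real. *)
Fixpoint edag (s : expr R[i] J) : expr R[i] J :=
  match s with
  | ecst c => ecst (conjc c)
  | eX0 => eX0
  | eXp => eXm
  | eXm => eXp
  | eshift g r => eshift (omap tau g) r
  | eadd s t => eadd (edag s) (edag t)
  | emul s t => emul (edag t) (edag s)
  end.

Lemma no_Xpm_dag s : no_Xpm (edag s) = no_Xpm s.
Proof. by elim: s => //= s -> t -> //; rewrite andbC. Qed.

Lemma efun_dag s u :
  efun rho sigma eps (edag s) u = (efun rho sigma eps s u^*)^*.
Proof.
elim: s => [c||||g r|s IHs t IHt|s IHs t IHt] /=;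
  rewrite ?IHs ?IHt ?conjc0 ?conjcK//.
- have -> : u^* + r%:~R * eps = (u + r%:~R * eps)^*.
    by rewrite rmorphD rmorphM /= eps_conj rmorph_int.
  by case: g => [j|] /=; rewrite ?sigma_conj ?[LHS]rho_conj.
- by rewrite rmorphD.
- by rewrite rmorphM mulrC.
Qed.

(** Conjugation exchanges the commutation relations of [eXp] with those of [eXm], with the index
    moved by one for the symbols, and fixes [econg_pm] and [econg_mp]. *)
Lemma edag_econg s t : econg rho sigma eps s t -> cls (edag s) = cls (edag t).
Proof.
elim=> {s t} //=.
- by move=> s t w _ -> _ ->.
- by move=> s s' t t' _ es _ et; rewrite !clsD es et.
- by move=> s s' t t' _ es _ et; rewrite !clsM es et.
- by move=> s t w; rewrite !clsD addrA.
- by move=> s t; rewrite !clsD addrC.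
- by move=> s; rewrite !clsD cls_cst conjc0 scale0r add0r.
- by move=> s t w; rewrite !clsM mulrA.
- by move=> s; rewrite !clsM cls_cst conjc1 scale1r mulr1.
- by move=> s; rewrite !clsM cls_cst conjc0 scale0r mulr0.
- by move=> s t w; rewrite !(clsM, clsD) mulrDr.
- by move=> s t w; rewrite !(clsM, clsD) mulrDl.
- by move=> c s; rewrite !clsM cls_cst -scalerAl -scalerAr mulr1 mul1r.
- move=> s t ns nt st; apply: cls_fun; rewrite ?no_Xpm_dag// => u.
  by rewrite !efun_dag st.
- rewrite !(clsM, clsD) !cls_cst -!scalerAr !mulr1 conjcN1 scaleN1r eps_conj.
  have -> : cls eX0 * cls eXm = _ := X0_Xm _ _ _.
  by rewrite mulrBr opprB addrC subrK -scalerAr mulr1.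
- rewrite !(clsM, clsD) !cls_cst -!scalerAr !mulr1 conjcN1 scaleN1r.
  have -> : cls eX0 * cls eXp = _ := X0_Xp _ _ _.
  rewrite mulrDr opprD addrA subrr add0r -scalerAr mulr1.
  by rewrite conjcN eps_conj scaleNr.
- move=> g r; apply/cls_eqP; apply: econg_sym.
  by have := econg_shift_m rho sigma eps (omap tau g) (r + 1); rewrite addrK.
- move=> g r; apply/cls_eqP; apply: econg_sym.
  by have := econg_shift_p rho sigma eps (omap tau g) (r - 1); rewrite subrK.
- by apply/cls_eqP; exact: econg_pm.
- by apply/cls_eqP; exact: econg_mp.
Qed.

Lemma exists_conjugation : exists dag : A -> A, is_conjugation dag.
Proof.
pose dag (a : A) := cls (edag (repr a)).
have dagE s : dag (cls s) = cls (edag s).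
  by apply: edag_econg; apply/cls_eqP; rewrite cls_repr.
exists dag; split=> [a b|c a|a b||f a [s [ns sf ->]]].
- have [s ->] := cls_surj a; have [t ->] := cls_surj b.
  by rewrite -clsD !dagE -clsD.
- have [s ->] := cls_surj a.
  have -> : c *: cls s = cls (emul (ecst c) s).
    by rewrite clsM cls_cst -scalerAl mul1r.
  by rewrite !dagE /= clsM cls_cst -scalerAr mulr1.
- have [s ->] := cls_surj a; have [t ->] := cls_surj b.
  by rewrite -clsM !dagE -clsM.
- by split; [exact: (dagE eX0)|exact: (dagE eXp)|exact: (dagE eXm)].
- exists (edag s); rewrite no_Xpm_dag; split=> // [u|]; last exact: dagE.
  by rewrite efun_dag sf.
Qed.

End Conjugation.

(** * Compatibility of the map with conjugation *)

Section PreservesConjugation.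
Variable R : realType.
Local Notation C := R[i].
Variables (rho1 rho2 sp sm : C -> C) (eps1 eps2 lam : C).

Local Notation A1 := (alg rho1 eps1).
Local Notation A2 := (enlarged_alg rho2 sp sm eps2).
Local Notation xi u := (eps1 / eps2 * u + lam).

Variable phi : {lrmorphism A1 -> A2}.
Hypothesis phi_map : is_the_map lam phi.

Lemma conj_real_eq (z : C) : (z^* == z) = (z \is Num.real).
Proof.
case: z => a b; rewrite complex_real eq_complex /= eqxx /=.
by rewrite -subr_eq0 -opprD oppr_eq0 -mulr2n mulrn_eq0.
Qed.

Let spE : function_of_X0 sp (Xsig true 0 : A2).
Proof. exact: (function_of_X0_sig0 _ _ _ true). Qed.

Let smE : function_of_X0 sm (Xsig false 0 : A2).
Proof. exact: (function_of_X0_sig0 _ _ _ false). Qed.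

(** With weight 1, [Xm] acts as a pure translation and loses nothing, even at zeros of [rho2].
    Testing on the constant function 1 reads off the values. *)
Lemma Xm_mul_inj (f g : C -> C) (a b : A2) :
  function_of_X0 f a -> function_of_X0 g b -> Xm * a = Xm * b -> f =1 g.
Proof.
move=> fa gb ab u.
have w v : rho2 v * 1 = rho2 v by exact: mulr1.
have := congr1 (fun a => sact rho2 (fun=> 1) a (fun=> 1) (u - eps2)) ab.
rewrite /= !sactM// !sactXm//.
rewrite (@sact_fun _ _ _ _ _ rho2 (fun=> 1) w _ _ _ _ fa).
rewrite (@sact_fun _ _ _ _ _ rho2 (fun=> 1) w _ _ _ _ gb).
by rewrite !mul1r !mulr1 subrK.
Qed.

Hypothesis eps1_real : eps1 \is Num.real.
Hypothesis eps2_real : eps2 \is Num.real.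

Let eps_conj : (eps1 / eps2)^* = eps1 / eps2.
Proof. by apply/eqP; rewrite conj_real_eq rpred_div. Qed.

(** The image of [Xp] yields the condition on [sp] and [sm], and the image of [X0] yields the
    reality of [lam]. *)
Lemma preserves_conjugation_sigma : preserves_conjugation phi ->
  (forall u, sm u = (sp u^*)^*) /\ lam \is Num.real.
Proof.
have [phi0 phip phim phif] := phi_map.
move=> [dag1 [dag2 [[_ _ _ [dag10 dag1p _] _]
  [_ _ dag2M [_ dag2p _] dag2f] comm]]].
split.
- apply: (Xm_mul_inj smE (dag2f _ _ spE)).
  by rewrite -phim -dag1p comm phip dag2M dag2p.
- rewrite -conj_real_eq; apply/eqP.
  have xiE := phif _ _ (function_of_X0_X0 _ _ _).
  have xiE' := dag2f _ _ xiE.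
  rewrite -comm dag10 in xiE'.
  (* Applied to one and the same element, [Xm_mul_inj] says that it denotes only one function; at 0
     the linear term drops out. *)
  have := Xm_mul_inj xiE' xiE erefl 0.
  by rewrite /= conjc0 mulr0 add0r.
Qed.

(** For functions of [X0], reflection commutes with the affine map because its coefficients are
    real. Together with [Xp] and [Xm] this covers all generators, and both sides reverse
    products. *)
Lemma the_map_conj dag1 dag2 :
    is_conjugation dag1 -> is_conjugation dag2 ->
    (forall u, sm u = (sp u^*)^*) -> lam \is Num.real ->
  forall a, phi (dag1 a) = dag2 (phi a).
Proof.
have [phi0 phip phim phif] := phi_map.
move=> [dag1D _ dag1M [_ dag1p dag1m] dag1f].
move=> [dag2D _ dag2M [_ dag2p dag2m] dag2f].
move=> smsp lam_real a; have [s ->] := cls_surj a.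
have fun_case f b : function_of_X0 f b -> phi (dag1 b) = dag2 (phi b).
  move=> fb; apply: function_of_X0_inj (phif _ _ (dag1f _ _ fb))
    (dag2f _ _ (phif _ _ fb)) => u.
  congr (f _)^*; rewrite rmorphD rmorphM /= eps_conj; congr (_ + _).
  by apply/eqP; rewrite conj_real_eq.
elim: s => [c||||g r|s IHs t IHt|s IHs t IHt].
- exact: fun_case (function_of_X0_cls _ _ _ _).
- exact: fun_case (function_of_X0_cls _ _ _ _).
- rewrite [_ eXp]/(Xp : A1) dag1p phip phim dag2M dag2p; congr (_ * _).
  exact: function_of_X0_inj smsp smE (dag2f _ _ spE).
- rewrite [_ eXm]/(Xm : A1) dag1m phip phim dag2M dag2m; congr (_ * _).
  apply: function_of_X0_inj spE (dag2f _ _ smE) => u.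
  by rewrite smsp !conjcK.
- exact: fun_case (function_of_X0_cls _ _ _ _).
- rewrite clsD dag1D !rmorphD dag2D; exact: (congr2 +%R IHs IHt).
- rewrite clsM dag1M !rmorphM dag2M; exact: (congr2 *%R IHt IHs).
Qed.

End PreservesConjugation.

(** * Surfaces and positivity sets *)

Section RealGeometry.
Variable R : realType.
Implicit Types (A B : set R) (rho : R[i] -> R[i]).

Lemma continuous_pair (T U V : topologicalType) (f : T -> U) (g : T -> V) :
  continuous f -> continuous g -> continuous (fun q => (f q, g q)).
Proof. by move=> cf cg q; exact: cvg_pair (cf q) (cg q). Qed.

(** [p] is the ratio of the radii of corresponding horizontal circles; [f] divides it out and undoes
    the affine change of height. *)
Lemma homeomorphic_surface rho1 rho2 (c l : R) (p : R -> R) :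
    c != 0 -> continuous p -> (forall t, p t != 0) ->
    (forall t : R, rho1 (c * t + l)%:C = rho2 t%:C * (p t ^+ 2)%:C) ->
  homeomorphic (surface rho1) (surface rho2).
Proof.
move=> c0 cp p0 rhoE.
pose tau z := c^-1 * (z - l).
have tauK z : c * tau z + l = z by rewrite mulVKf// subrK.
have Ktau z : tau (c * z + l) = z by rewrite /tau addrK mulKf.
pose f (q : R * R * R) : R * R * R :=
  ((p (tau q.2))^-1 * q.1.1, (p (tau q.2))^-1 * q.1.2, tau q.2).
pose g (q : R * R * R) : R * R * R :=
  (p q.2 * q.1.1, p q.2 * q.1.2, c * q.2 + l).
have c1 : continuous (fun q : R * R * R => q.1.1).
  move=> q; apply: (@continuous_comp _ _ _ fst fst); exact: cvg_fst.
have c2 : continuous (fun q : R * R * R => q.1.2).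
  move=> q; apply: (@continuous_comp _ _ _ fst snd); first exact: cvg_fst.
  exact: cvg_snd.
have c3 : continuous (fun q : R * R * R => q.2) by move=> q; exact: cvg_snd.
have ctau : continuous (fun q : R * R * R => tau q.2).
  move=> q; apply: cvgM; first exact: cvg_cst.
  apply: cvgB; [exact: c3|exact: cvg_cst].
have cpt : continuous (fun q : R * R * R => (p (tau q.2))^-1).
  move=> q; apply: cvgV => //.
  apply: (@continuous_comp _ _ _ (fun q => tau q.2) p); first exact: ctau.
  exact: cp.
have cpq : continuous (fun q : R * R * R => p q.2).
  by move=> q; apply: (@continuous_comp _ _ _ snd p); [exact: c3|exact: cp].
have caff : continuous (fun q : R * R * R => c * q.2 + l).
  move=> q; apply: cvgD; last exact: cvg_cst.
  by apply: cvgM; [exact: cvg_cst|exact: c3].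
exists f, g; split.
- apply: continuous_subspaceT; apply: continuous_pair => //.
  by apply: continuous_pair => q; apply: cvgM;
    [exact: cpt|exact: c1|exact: cpt|exact: c2].
- apply: continuous_subspaceT; apply: continuous_pair => //.
  by apply: continuous_pair => q; apply: cvgM;
    [exact: cpq|exact: c1|exact: cpq|exact: c2].
- move=> [[x y] z]; rewrite /surface /f /g /= -{1}(tauK z) rhoE => xyE.
  split; last by rewrite tauK !mulVKf.
  rewrite !exprMn -mulrDr rmorphM /= xyE mulrCA -rmorphM -exprMn mulVf//.
  by rewrite expr1n mulr1.
- move=> [[x y] z]; rewrite /surface /f /g /= => xyE.
  split; last by rewrite Ktau !mulKf.
  by rewrite rhoE -xyE -rmorphM !exprMn -mulrDr mulrC.
Qed.

Lemma affine_has_lbound A B (c l : R) : 0 < c ->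
  (forall u, A (c * u + l) <-> B u) -> has_lbound B -> has_lbound A.
Proof.
move=> c0 AB [x Bx]; exists (c * x + l) => a.
rewrite -[a](subrK l) -[a - l](@mulVKf _ c) ?gt_eqF// => /AB/Bx xa.
by rewrite lerD2r ler_pM2l.
Qed.

Lemma affine_has_ubound A B (c l : R) : 0 < c ->
  (forall u, A (c * u + l) <-> B u) -> has_ubound B -> has_ubound A.
Proof.
move=> c0 AB [x Bx]; exists (c * x + l) => a.
rewrite -[a](subrK l) -[a - l](@mulVKf _ c) ?gt_eqF// => /AB/Bx xa.
by rewrite lerD2r ler_pM2l.
Qed.

Lemma affine_sup_le A B (c l : R) : 0 < c -> B !=set0 -> has_ubound B ->
  (forall u, A (c * u + l) <-> B u) -> sup A <= c * sup B + l.
Proof.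
move=> c0 [b Bb] uB AB; apply: ge_sup; first by exists (c * b + l); apply/AB.
move=> a; rewrite -[a](subrK l) -[a - l](@mulVKf _ c) ?gt_eqF// => /AB Ba.
by rewrite lerD2r ler_pM2l// ub_le_sup.
Qed.

Lemma affine_inf_ge A B (c l : R) : 0 < c -> B !=set0 -> has_lbound B ->
  (forall u, A (c * u + l) <-> B u) -> c * inf B + l <= inf A.
Proof.
move=> c0 [b Bb] lB AB; apply: lb_le_inf; first by exists (c * b + l); apply/AB.
move=> a; rewrite -[a](subrK l) -[a - l](@mulVKf _ c) ?gt_eqF// => /AB Ba.
by rewrite lerD2r ler_pM2l// ge_inf.
Qed.

Lemma interval_length_affine_pos A B (c l : R) : 0 < c ->
  (forall u, A (c * u + l) <-> B u) ->
  interval_length A = (interval_length B * c%:E)%E.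
Proof.
move=> c0 AB.
have c'0 : 0 < c^-1 by rewrite invr_gt0.
have BA u : B (c^-1 * u + - (c^-1 * l)) <-> A u.
  by rewrite -AB -mulrBr mulVKf ?gt_eqF// subrK.
rewrite /interval_length.
case: asboolP => [[lA uA]|bA]; case: asboolP => [[lB uB]|bB].
(* For the empty set [sup] and [inf] have the default value 0 and do not transform affinely, but
   both lengths are 0. *)
- have [B0|/set0P B0] := eqVneq B set0.
    have -> : A = set0 by apply/seteqP; split=> // u /BA; rewrite B0.
    by rewrite B0 sup0 inf0 subrr mul0e.
  have A0 : A !=set0 by case: B0 => b Bb; exists (c * b + l); apply/AB.
  (* One inequality comes from the affine map, the other from the same lemma for its inverse. *)
  have sE : sup A = c * sup B + l.
    apply/eqP; rewrite eq_le (affine_sup_le c0 B0 uB AB) /=.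
    have := affine_sup_le c'0 A0 uA BA.
    by rewrite -mulrBr ler_pdivlMl// lerBrDr.
  have iE : inf A = c * inf B + l.
    apply/eqP; rewrite eq_le (affine_inf_ge c0 B0 lB AB) andbT.
    have := affine_inf_ge c'0 A0 lA BA.
    by rewrite -mulrBr ler_pdivrMl// lerBlDr.
  by rewrite sE iE -EFinM; congr (_%:E); ring.
- case: bB; split; first exact: affine_has_lbound BA lA.
  exact: affine_has_ubound BA uA.
- case: bA; split; first exact: affine_has_lbound AB lB.
  exact: affine_has_ubound AB uB.
- by rewrite gt0_mulye// lte_fin.
Qed.

(** Since [inf] is defined as minus the [sup] of the reflected set, reflection exchanges the two
    terms of the length. *)
Lemma interval_length_opp A B : (forall u, A (- u) <-> B u) ->
  interval_length A = interval_length B.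
Proof.
move=> AB; have -> : A = [set - x | x in B].
  apply/seteqP; split=> [a Aa|_ [b Bb <-]]; last exact/AB.
  by exists (- a); rewrite ?opprK//; apply/AB; rewrite opprK.
rewrite /interval_length.
have -> : (has_lbound [set - x | x in B] /\ has_ubound [set - x | x in B]) =
    (has_lbound B /\ has_ubound B).
  by apply/propext; rewrite -has_ub_lbN -has_lb_ubN; split=> -[].
case: ifP => // _; congr (_%:E).
rewrite /inf image_comp.
have -> : [set (-%R \o -%R) x | x in B] = B.
  by rewrite -[RHS]image_id; apply: eq_imagel => x _ /=; rewrite opprK.
by rewrite addrC opprK; congr (_ + _); rewrite opprK.
Qed.

Lemma interval_length_affine A B (c l : R) : c != 0 ->
  (forall u, A (c * u + l) <-> B u) ->
  interval_length A = (interval_length B * `|c|%:E)%E.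
Proof.
move=> c0 AB; have [cp|cn|/eqP] := ltgtP c 0; last by rewrite (negPf c0).
  have AB' u : A (- c * u + l) <-> [set v | B (- v)] u.
    by rewrite /= -AB mulrN mulNr.
  rewrite ltr0_norm// (interval_length_affine_pos _ AB') ?oppr_gt0//.
  by congr (_ * _)%E; apply: interval_length_opp => u /=; rewrite opprK.
by rewrite gtr0_norm//; exact: interval_length_affine_pos AB.
Qed.

End RealGeometry.

(** * The conjugation criterion and its geometric consequences *)

Section Consequences.
Variable R : realType.
Local Notation K := (R[i] : numFieldType).
Variables (rho1 rho2 sp sm : R[i] -> R[i]) (eps1 eps2 lam : R[i]).
Hypothesis map_dataH : map_data rho1 rho2 sp sm eps1 eps2 lam.

Lemma norm_analytic_continuous :
  continuous (fun t : R => complex.Re `|sp t%:C|).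
Proof.
have [[_ _ span _] _ _ _ _] := map_dataH.
move=> t; apply/cvgrPdist_le => d d0.
have /cvgrPdist_le/(_ d%:C) := @analytic_continuous K _ span t%:C.
rewrite (ltcR 0) => /(_ d0)/near_complexP[r r0 rP].
apply/nbhs_ballP; exists r; first exact: r0.
move=> s; rewrite /= distrC => sr.
have := rP s%:C; rewrite -rmorphB norm_real_complex ltcR => /(_ sr).
have pE u : `|sp u%:C| = (complex.Re `|sp u%:C|)%:C.
  by rewrite RRe_real ?normr_real.
move/(le_trans (ler_dist_dist _ _)).
by rewrite -lecR -norm_real_complex rmorphB /= -!pE.
Qed.

Variable phi : {lrmorphism alg rho1 eps1 -> enlarged_alg rho2 sp sm eps2}.
Hypothesis phi_map : is_the_map lam phi.
Hypotheses (rho1_real : real_function rho1) (rho2_real : real_function rho2).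
Hypotheses (eps1_real : eps1 \is Num.real) (eps2_real : eps2 \is Num.real).

Lemma preserves_conjugationP : preserves_conjugation phi <->
  (forall u : R, (sp u%:C)^* = sm u%:C) /\ lam \is Num.real.
Proof.
have [[rho1an rho2an span sman] _ _ eps2_neq0 _] := map_dataH.
split=> [pc|[spsm lam_real]].
  have [smE lam_real] := preserves_conjugation_sigma phi_map pc.
  by split=> // u; rewrite smE conjc_real.
have smE : sm =1 (fun u => (sp u^*)^*).
  apply: (eq_analytic sman (analytic_conj span)) => x.
  by rewrite conjc_real -[LHS]spsm.
have conj1 : conjc eps1 = eps1 by apply/eqP; rewrite conj_real_eq.
have conj2 : conjc eps2 = eps2 by apply/eqP; rewrite conj_real_eq.
have rho1c z : rho1 z = conjc (rho1 (conjc z)).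
  by rewrite [RHS]real_analytic_conj.
have rho2c z : rho2 z = conjc (rho2 (conjc z)).
  by rewrite [RHS]real_analytic_conj.
have [dag1 dag1H] := @exists_conjugation R void rho1 (of_void (R[i] -> R[i]))
  eps1 id conj1 rho1c (fun j => match j with end).
pose sigma b := if b then sp else sm.
(* Reflection exchanges [sp] and [sm], so the enlarged algebra has a conjugation with [negb] acting
   on the indices. *)
have sigma_conj b z : sigma (~~ b) z = conjc (sigma b (conjc z)).
  by case: b; rewrite /= smE// !conjcK.
have [dag2 dag2H] :=
  @exists_conjugation R bool rho2 sigma eps2 negb conj2 rho2c sigma_conj.
exists dag1, dag2; split=> // a.
exact: (the_map_conj phi_map eps1_real eps2_real dag1H dag2H).
Qed.

Hypothesis eps1_neq0 : eps1 != 0.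
Hypothesis phi_conj : preserves_conjugation phi.

Let p (t : R) : R := complex.Re `|sp t%:C|.
Let c : R := complex.Re eps1 / complex.Re eps2.
Let l : R := complex.Re lam.

Let p_neq0 t : p t != 0.
Proof.
have [_ sp0 _ _ _] := map_dataH.
rewrite /p -(inj_eq (@complexI R)) RRe_real ?normr_real//.
by rewrite (normr_eq0 (sp _)) sp0.
Qed.

(** On the real line [sm] is the conjugate of [sp], so their product is the square of the norm.
    Surfaces and positivity sets both depend on this real form of the factorization. *)
Let rho_real t : rho1 (c * t + l)%:C = rho2 t%:C * (p t ^+ 2)%:C.
Proof.
have [_ _ _ _ rhoE] := map_dataH.
have [spsm lam_real] := preserves_conjugationP.1 phi_conj.
have -> : (c * t + l)%:C = eps1 / eps2 * t%:C + lam.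
  by rewrite rmorphD !rmorphM fmorphV /= !RRe_real.
rewrite rhoE -mulrA -[sm _]spsm; congr (_ * _).
by rewrite -[LHS]sqr_normc rmorphXn /= RRe_real// normr_real.
Qed.

Let eps2_neq0 : eps2 != 0.
Proof. by have [_ _ _ ? _] := map_dataH. Qed.

Let e1_neq0 : complex.Re eps1 != 0.
Proof. by rewrite -(inj_eq (@complexI R)) RRe_real. Qed.

Let e2_neq0 : complex.Re eps2 != 0.
Proof. by rewrite -(inj_eq (@complexI R)) RRe_real. Qed.

Let c_neq0 : c != 0.
Proof. by rewrite mulf_neq0// invr_eq0. Qed.

Lemma the_map_homeomorphic : homeomorphic (surface rho1) (surface rho2).
Proof.
exact: homeomorphic_surface c_neq0 norm_analytic_continuous p_neq0 rho_real.
Qed.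

Lemma pos_set_length : interval_length (pos_set rho1) =
  (interval_length (pos_set rho2) * `|c|%:E)%E.
Proof.
apply: (interval_length_affine c_neq0 (l := l)) => u.
(* The factor is strictly positive, so the affine map preserves positivity in both directions. *)
have p2 : 0 < (p u ^+ 2)%:C by rewrite (ltcR 0) exprn_even_gt0//= p_neq0.
by rewrite /pos_set /= rho_real pmulr_lgt0.
Qed.

Lemma pos_set_length_norm :
  (interval_length (pos_set rho1) / `|complex.Re eps1|%:E =
   interval_length (pos_set rho2) / `|complex.Re eps2|%:E)%E.
Proof.
rewrite pos_set_length !inver !normr_eq0 (negPf e1_neq0) (negPf e2_neq0).
rewrite -muleA -EFinM; congr (_ * _%:E)%E.
by rewrite /c normrM normfV mulrAC divff ?mul1r// normr_eq0.
Qed.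

(** Lengths scale by the absolute value of [c]; for a negative ratio the signed quotients could
    differ by a sign. *)
Lemma pos_set_length_signed : 0 < eps1 / eps2 ->
  (interval_length (pos_set rho1) / (complex.Re eps1)%:E =
   interval_length (pos_set rho2) / (complex.Re eps2)%:E)%E.
Proof.
have -> : eps1 / eps2 = c%:C by rewrite rmorphM fmorphV /= !RRe_real.
rewrite (ltcR 0) => c0.
rewrite pos_set_length !inver (negPf e1_neq0) (negPf e2_neq0).
rewrite -muleA -EFinM; congr (_ * _%:E)%E.
by rewrite gtr0_norm// /c mulrAC divff ?mul1r.
Qed.

End Consequences.

(** By [the_map_function], a preimage of the element denoting [cexp] would make [cexp] an expression
    in constants, the variable and translates of 0. *)
Lemma not_surjective_example (R : realType) (phi : {lrmorphism
    alg (fun=> 0 : R[i]) 1 -> enlarged_alg (fun=> 0) (@cexp R) (fun=> 1) 1}) :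
  is_the_map 0 phi -> ~ (forall b, exists a, phi a = b).
Proof.
move=> phi_map /(_ (Xsig true 0))[a aE].
have [s ns sE] : exists2 s : expr R[i] void, no_Xpm s &
    forall u, cexp u =
      efun (fun=> 0) (of_void (R[i] -> R[i])) 1 s (1 / 1 * u + 0).
  apply: (the_map_function (oner_neq0 _) phi_map (a := a)).
  by rewrite aE; exact: (function_of_X0_sig0 _ _ _ true).
(* The translates of the zero function contribute nothing and the further family is empty, so only
   polynomials arise. *)
have [q qE] : exists q : {poly R[i]},
    forall u, efun (fun=> 0) (of_void (R[i] -> R[i])) 1 s u = q.[u].
  elim: s ns {sE} => //=
    [c _|_|[[]|] r _|s IHs t IHt /andP[ns nt]|s IHs t IHt /andP[ns nt]].
  - by exists c%:P => u; rewrite hornerC.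
  - by exists 'X => u; rewrite hornerX.
  - by exists 0 => u; rewrite horner0.
  - have [q qE] := IHs ns; have [q' qE'] := IHt nt.
    by exists (q + q') => u; rewrite hornerD qE qE'.
  - have [q qE] := IHs ns; have [q' qE'] := IHt nt.
    by exists (q * q') => u; rewrite hornerM qE qE'.
apply: (@cexp_not_polynomial R q) => z.
by rewrite sE qE divr1 mul1r addr0.
Qed.

Lemma analytic_cst (K : numFieldType) (c : K) : analytic_fun (fun=> c).
Proof.
move=> z0; exists (fun n => if n is 0%N then c else 0); near=> z.
apply: cvg_near_cst; near=> n; rewrite /series/= big_mkord.
have n0 : (0 < n)%N by near: n; exact: nbhs_infty_gt.
rewrite -(prednK n0) big_ord_recl expr0 mulr1 big1 ?addr0// => i _.
by rewrite mul0r.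
Unshelve. all: by end_near. Qed.

Theorem theorem3 (R : realType) :
  (forall (rho1 rho2 sp sm : R[i] -> R[i]) (eps1 eps2 lam : R[i]),
    map_data rho1 rho2 sp sm eps1 eps2 lam ->
    (exists phi : {lrmorphism alg rho1 eps1 ->
                              enlarged_alg rho2 sp sm eps2},
       is_the_map lam phi) /\
    (forall phi : {lrmorphism alg rho1 eps1 ->
                              enlarged_alg rho2 sp sm eps2},
       is_the_map lam phi ->
       (eps1 != 0 -> injective phi) /\
       (real_function rho1 -> real_function rho2 ->
        eps1 \is Num.real -> eps2 \is Num.real ->
        (preserves_conjugation phi <->
         (forall u : R, (sp u%:C)^* = sm u%:C) /\ lam \is Num.real) /\
        (eps1 != 0 -> preserves_conjugation phi ->
         homeomorphic (surface rho1) (surface rho2) /\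
         (connected (pos_set rho1) -> connected (pos_set rho2) ->
          (0 < eps1 / eps2 ->
           (interval_length (pos_set rho1) / (complex.Re eps1)%:E =
            interval_length (pos_set rho2) / (complex.Re eps2)%:E)%E) /\
          (interval_length (pos_set rho1) / `|complex.Re eps1|%:E =
           interval_length (pos_set rho2) / `|complex.Re eps2|%:E)%E))))) /\
  (exists (rho1 rho2 sp sm : R[i] -> R[i]) (eps1 eps2 lam : R[i]),
    [/\ map_data rho1 rho2 sp sm eps1 eps2 lam, eps1 != 0
      & forall phi : {lrmorphism alg rho1 eps1 ->
                                 enlarged_alg rho2 sp sm eps2},
          is_the_map lam phi ->
          ~ (forall b : enlarged_alg rho2 sp sm eps2, exists a, phi a = b)]).
Proof.
split=> [rho1 rho2 sp sm eps1 eps2 lam data|].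
  have [_ sp0 sm0 eps2_neq0 rhoE] := data.
  split=> [|phi phi_map]; first exact: exists_the_map eps2_neq0 rhoE.
  split=> [eps1_neq0|rho1_real rho2_real eps1_real eps2_real].
    exact: the_map_inj eps2_neq0 sp0 sm0 _ phi_map eps1_neq0.
  split=> [|eps1_neq0 phi_conj].
    exact: (preserves_conjugationP data phi_map).
  split; first exact: (the_map_homeomorphic data phi_map).
  move=> _ _; split=> [c0|].
    exact: (pos_set_length_signed data phi_map).
  exact: (pos_set_length_norm data phi_map).
exists (fun=> 0), (fun=> 0), (@cexp R), (fun=> 1), 1, 1, 0; split.
- split=> [|u|u||u].
  + split; [exact: analytic_cst|exact: analytic_cst|exact: analytic_cexp|].
    exact: analytic_cst.
  + exact: cexp_neq0.
  + exact: oner_neq0.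
  + exact: oner_neq0.
  + by rewrite !mul0r.
- exact: oner_neq0.
- exact: not_surjective_example.
Qed.
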